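(* Let $n,k$ be positive integers and let $(f_1,\ldots,f_k)$ be a $k$-tuple of operators in the noncommutative analytic Toeplitz algebra $F_n^\infty$. Then: (i) for every $m\geq 0$, $W(P_{\mathcal P_m}f_1|_{\mathcal P_m},\ldots,P_{\mathcal P_m}f_k|_{\mathcal P_m})$ is a convex compact subset of $\mathbb C^k$, where $\mathcal P_m$ is the set of all polynomials in $F^2(H_n)$ of degree $\le m$; (ii) $\overline{W(f_1,\ldots,f_k)}$ is a convex compact subset of $\mathbb C^k$; (iii) $(\lambda_1,\ldots,\lambda_k)\notin\sigma_r(f_1,\ldots,f_k)$ if and only if there is $\delta>0$ such that $$(\lambda_1I-f_1)(\overline\lambda_1I-f_1^* )+\cdots+(\lambda_kI-f_k)(\overline\lambda_kI-f_k^* )\ge\delta^2I;$$ (iv) $\sigma_r(f_1,\ldots,f_k)$ is a compact subset of $\mathbb C^k$ and $$\{(f_1(\lambda),\ldots,f_k(\lambda)):\lambda\in\mathbb B_n\}^-\subseteq\sigma_r(f_1,\ldots,f_k)\subseteq\overline{W(f_1,\ldots,f_k)}.$$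
   Context: $F^2(H_n)=\bigoplus_{k\ge0}H_n^{\otimes k}$ is the full Fock space of an $n$-dimensional complex Hilbert space $H_n$ with orthonormal basis $e_1,\ldots,e_n$; it has orthonormal basis $e_\alpha=e_{i_1}\otimes\cdots\otimes e_{i_k}$ for $\alpha=g_{i_1}\cdots g_{i_k}$ in the free semigroup $\mathbb F_n^+$ on $g_1,\ldots,g_n$ ($e_{g_0}=1$ for the identity $g_0$). $S_i\psi=e_i\otimes\psi$ are the left creation operators and $F_n^\infty$ is the WOT-closed algebra generated by $S_1,\ldots,S_n$ and $I$. $\mathcal P_m=\mathrm{span}\{e_\alpha:|\alpha|\le m\}$ and $P_{\mathcal P_m}$ is the orthogonal projection onto it. $\mathbb B_n$ is the open unit ball of $\mathbb C^n$. For $f\in F_n^\infty$ with $f1=\sum_\alpha a_\alpha e_\alpha$ and $\lambda\in\mathbb B_n$, $f(\lambda):=\sum_\alpha a_\alpha\lambda_\alpha$, where $\lambda_\alpha=\lambda_{i_1}\cdots\lambda_{i_k}$. The joint numerical range of operators $X_1,\ldots,X_k$ on a Hilbert space is $W(X_1,\ldots,X_k)=\{(\langle X_1h,h\rangle,\ldots,\langle X_kh,h\rangle):\|h\|=1\}$. Here $\sigma_r(f_1,\ldots,f_k)$ is the joint right spectrum with respect to $F_n^\infty$: the set of $(\lambda_1,\ldots,\lambda_k)\in\mathbb C^k$ such that the right ideal of $F_n^\infty$ generated by $\lambda_1I-f_1,\ldots,\lambda_kI-f_k$ does not contain the identity. The superscript $^-$ denotes closure. *)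

(* Defs.v *)
From HB Require Import structures.
From mathcomp Require Import all_boot all_order all_algebra.
From mathcomp Require Import complex ring lra.
From mathcomp Require Import all_classical all_reals all_analysis.
Set Implicit Arguments.
Unset Strict Implicit.
Unset Printing Implicit Defensive.
Import Order.TTheory GRing.Theory Num.Theory.
Import numFieldNormedType.Exports.
Local Open Scope classical_set_scope.
Local Open Scope ring_scope.
Local Open Scope complex_scope.

Section FockSpace.
Variables (R : realType) (n : nat).
Implicit Types (x y : seq 'I_n -> R[i]).

Definition sqnorm_deg x (k : nat) : R :=
  \sum_(w : k.-tuple 'I_n) Normc.normc (x w) ^+ 2.

(* Elements of the free semigroup on n generators are words, i.e. sequences
   over 'I_n. The restriction of x to words of length k is a vector of the
   k-th tensor power of C^n, and x is in the Fock space when the squared norms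
   of these components are summable. *)
Definition in_fock : {pred (seq 'I_n -> R[i])} :=
  [pred x | `[< cvgn (series (sqnorm_deg x)) >]].

Lemma sqnorm_deg_ge0 x k : 0 <= sqnorm_deg x k.
Proof. by apply: sumr_ge0 => w _; exact: sqr_ge0. Qed.

Lemma normc_sqr (z : R[i]) :
  Normc.normc z ^+ 2 = complex.Re z ^+ 2 + complex.Im z ^+ 2.
Proof. by case: z => a b /=; rewrite sqr_sqrtr// addr_ge0// sqr_ge0. Qed.

Lemma sqnorm_degD x y k :
  sqnorm_deg (x + y) k <= 2 * sqnorm_deg x k + 2 * sqnorm_deg y k.
Proof.
rewrite !mulr_sumr -big_split/=; apply: ler_sum => w _.
rewrite !normc_sqr -[(x + y) w]/(x w + y w); case: (x w) (y w) => a b [c d] /=.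
have := sqr_ge0 (a - c); have := sqr_ge0 (b - d).
rewrite !sqrrB !sqrrD; lra.
Qed.

Lemma sqnorm_degZ (a : R[i]) x k :
  sqnorm_deg (a *: x) k = Normc.normc a ^+ 2 * sqnorm_deg x k.
Proof.
by rewrite mulr_sumr; apply: eq_bigr => w _; rewrite Normc.normcM exprMn.
Qed.

Fact in_fock_submod_closed : submod_closed in_fock.
Proof.
split=> [|a x y /asboolP xH /asboolP yH]; apply/asboolP.
  apply: (cvgP 0); apply: cvg_near_cst; apply: nearW => k.
  rewrite /series/= big1// => j _; rewrite /sqnorm_deg big1// => w _.
  by rewrite normc_sqr/= expr0n/= addr0.
pose v k := 2 * (Normc.normc a ^+ 2 * sqnorm_deg x k)
            + 2 * sqnorm_deg y k.
have u0 k : 0 <= sqnorm_deg (a *: x + y) k by exact: sqnorm_deg_ge0.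
have v0 k : 0 <= v k.
  rewrite addr_ge0// mulr_ge0 ?sqnorm_deg_ge0//.
  by rewrite mulr_ge0 ?sqr_ge0// sqnorm_deg_ge0.
have uv k : sqnorm_deg (a *: x + y) k <= v k.
  by rewrite (le_trans (sqnorm_degD _ _ _))// sqnorm_degZ.
apply: series_le_cvg u0 v0 uv _.
apply: is_cvg_seriesD; last exact: is_cvg_seriesZ.
apply: is_cvg_seriesZ; exact: is_cvg_seriesZ.
Qed.

HB.instance Definition _ :=
  GRing.isSubmodClosed.Build _ _ in_fock in_fock_submod_closed.

Record fock := Fock { fval :> seq 'I_n -> R[i]; _ : fval \in in_fock }.
HB.instance Definition _ := [isSub for fval].
HB.instance Definition _ := [Choice of fock by <:].
HB.instance Definition _ := [SubChoice_isSubLmodule of fock by <:].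

Definition evec_fun (v : seq 'I_n) : seq 'I_n -> R[i] := fun w => (w == v)%:R.

Fact evec_in_fock v : evec_fun v \in in_fock.
Proof.
apply/asboolP; rewrite -(is_cvg_series_restrict (size v).+1).
apply: (cvgP 0); apply: cvg_near_cst; apply: nearW => k.
rewrite /= big_nat_cond big1// => j /andP[/andP[vj _] _].
rewrite /sqnorm_deg big1// => w _; rewrite /evec_fun.
have /negPf -> : tval w != v.
  by apply: contraTN vj => /eqP <-; rewrite size_tuple ltnn.
by rewrite normc_sqr/= expr0n/= addr0.
Qed.

Definition evec (v : seq 'I_n) : fock := Fock (evec_in_fock v).

Definition creation_fun (i : 'I_n) (x : seq 'I_n -> R[i]) : seq 'I_n -> R[i] :=
  fun w => if w is j :: w' then (if j == i then x w' else 0) else 0.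

Lemma sqnorm_deg_creation0 i x : sqnorm_deg (creation_fun i x) 0 = 0.
Proof.
rewrite /sqnorm_deg big1// => w _.
by rewrite (tuple0 w) normc_sqr/= expr0n/= addr0.
Qed.

Lemma sqnorm_deg_creationS i x k :
  sqnorm_deg (creation_fun i x) k.+1 = sqnorm_deg x k.
Proof.
rewrite /sqnorm_deg.
pose h (p : 'I_n * k.-tuple 'I_n) := cons_tuple p.1 p.2.
rewrite (reindex h)/=; last first.
  exists (fun w => (thead w, [tuple of behead w])) => [[j w] _|w _].
    by congr pair; apply: val_inj.
  by rewrite [RHS]tuple_eta; apply: val_inj.
rewrite -(pair_bigA _ (fun j w =>
  Normc.normc (if j == i then x (tval w) else 0) ^+ 2))/=.
rewrite (bigD1 i)//= eqxx [X in _ + X]big1 ?addr0// => j /negPf ->.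
by rewrite big1// => w _; rewrite normc_sqr/= expr0n/= addr0.
Qed.

Fact creation_in_fock i (x : fock) : creation_fun i x \in in_fock.
Proof.
case: x => x /= /asboolP xH; apply/asboolP.
apply/cvg_ex; exists (limn (series (sqnorm_deg x))).
rewrite -cvg_shiftS.
suff -> : [sequence series (sqnorm_deg (creation_fun i x)) k.+1]_k
  = series (sqnorm_deg x) by [].
apply/funext => k; rewrite /series/= big_nat_recl// sqnorm_deg_creation0 add0r.
by apply: eq_bigr => j _; rewrite sqnorm_deg_creationS.
Qed.

Definition creation (i : 'I_n) (x : fock) : fock := Fock (creation_in_fock i x).

End FockSpace.

Section Operators.
Variables (R : realType) (n : nat).
Local Notation F2 := (fock R n).
Local Notation op := (F2 -> F2).

(* All families summed below are absolutely summable (products of two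
   square-summable families), so grouping the words by length is harmless. *)
Definition word_sum (a : seq 'I_n -> R[i]) : R[i] :=
  limn (series (fun k => \sum_(w : k.-tuple 'I_n) a w : R[i]^o)).

Definition inner (x y : F2) : R[i] := word_sum (fun w => x w * (y w)^*).

Definition hnorm (x : F2) : R := Num.sqrt (complex.Re (inner x x)).

Definition bounded_op (T : op) : Prop :=
  linear T /\ exists M : R, forall x, hnorm (T x) <= M * hnorm x.

Definition idop : op := idfun.

(* By the Riesz theorem the set below is a singleton for bounded T. *)
Definition adjoint (T : op) : op :=
  xget 0 [set T' | bounded_op T' /\
                   forall x y, inner (T x) y = inner x (T' y)].

Definition op_le (A B : op) : Prop :=
  forall h, inner (A h) h <= inner (B h) h.

Definition op_algebra (A : set op) : Prop :=
  [/\ A `<=` bounded_op,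
      forall a T U, A T -> A U -> A (a *: T + U)
    & forall T U, A T -> A U -> A (T \o U)].

(* The sets {X | |<(T - X) p.1, p.2>| < e for all p in s}, for finite s and
   e > 0, form a neighbourhood basis of T for the weak operator topology. *)
Definition wot_closed (A : set op) : Prop :=
  forall T, bounded_op T ->
    (forall (s : seq (F2 * F2)) (e : R), 0 < e ->
       exists2 X, A X &
         forall p, p \in s -> `|inner ((T - X) p.1) p.2| < e%:C) ->
    A T.

Definition Finfty : set op :=
  [set T | forall A : set op, op_algebra A -> wot_closed A ->
             A idop -> (forall i, A (@creation R n i)) -> A T].

Definition right_ideal (J : set op) : Prop :=
  [/\ J `<=` Finfty, J 0,
      forall T U, J T -> J U -> J (T + U)
    & forall T U, J T -> Finfty U -> J (T \o U)].

Definition right_ideal_gen (k : nat) (X : 'I_k -> op) : set op :=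
  [set T | forall J, right_ideal J -> (forall i, J (X i)) -> J T].

Definition right_spectrum (k : nat) (f : 'I_k -> op) : set 'rV[R[i]^o]_k :=
  [set l | ~ right_ideal_gen (fun i => l 0 i *: idop - f i) idop].

Definition poly_le (m : nat) : set F2 :=
  [set h | exists c : seq 'I_n -> R[i],
     h = \sum_(j < m.+1) \sum_(w : j.-tuple 'I_n) c w *: evec R w].

Definition orthproj (M : set F2) (x : F2) : F2 :=
  xget 0 [set y | M y /\ forall z, M z -> inner (x - y) z = 0].

(* Joint numerical range of operators on the subspace M; only the values of
   X i on M matter. *)
Definition num_range (M : set F2) (k : nat) (X : 'I_k -> op) :
    set 'rV[R[i]^o]_k :=
  [set \row_i inner (X i h) h | h in [set h | M h /\ hnorm h = 1]].

Definition unit_ball : set 'rV[R[i]^o]_n :=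
  [set l | \sum_i `|l 0 i| ^+ 2 < 1].

Definition point_eval (f : op) (l : 'rV[R[i]^o]_n) : R[i] :=
  word_sum (fun w => f (evec R [::]) w * \prod_(j <- w) l 0 j).

End Operators.

(* Main.v *)
(* Every operator of the algebra commutes with the right creation operators
   x |-> x (x) e_i, and conversely a bounded operator T commuting with them is the
   weak limit of its Cesaro means, which are polynomials in the left creation
   operators; so the algebra is the commutant of the right creations.

   Convexity: the values <f_i h, h>, h in P_m, are the traces of f_i against the
   rank-one density h h^*.  For any density r, write r = h h^* + s with s the Schur
   complement of the entry at the empty word.  Stripping the last letter,
   s'(u,v) = sum_i s(ui,vi), changes no trace against an operator of the commutant
   but strictly lowers the mean word length unless s = 0.  A density minimizing the
   mean word length under given traces hence has rank one, and the truncated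
   range is a linear image of the compact convex set of all densities.

   Right spectrum: with X_j = l_j - f_j and sum_j X_j X_j^* >= 2e, the operator
   A = sum_j X_j X_j^* - e satisfies
     A + e e_0 e_0^* = sum_i R_i A R_i^* + sum_j (X_j e_0)(X_j e_0)^*,
   where R_i is right creation and e_0 the vacuum.  This identity is solved by a
   transfer-function realization (the lurking isometry of the Toeplitz corona
   theorem), giving M_j in the commutant with sum_j X_j M_j = 1. *)
Require Import Defs.
From mathcomp Require Import all_boot all_order all_algebra.
From mathcomp Require Import complex zify ring lra.
From mathcomp Require Import all_classical all_reals all_analysis.
Set Implicit Arguments.
Unset Strict Implicit.
Unset Printing Implicit Defensive.
Import Order.TTheory GRing.Theory Num.Theory.
Import numFieldNormedType.Exports.
Local Open Scope classical_set_scope.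
Local Open Scope complex_scope.
Local Open Scope ring_scope.

(* In complex_scope, ^* denotes conjc; with ring_scope opened last it is the
   convertible Num.conj, to which it also resolves inside products in Defs. *)

(** * Complex sequences *)

(** In the range argument the Schur complement has zero row and column at the empty word, so every
    word that it charges has a last letter to strip. Traces survive because [T] maps e_(vi) to R_i
    (T e_v), and the mean length drops by exactly the trace of the stripped part. The full range is
    reached up to closure, through normalized truncations of a common degree. In the corona argument
    no square root of A is taken: the form <A x, x> is the stored energy of a system driven by
    words. The left side of the displayed identity is coercive, hence invertible, and its inverse
    plays the part of the lurking isometry. Each step dissipates energy, and summing over words
    telescopes; the output is thereby bounded by the input, which gives multipliers M_j of norm at
    most e^(-1/2). Points f(lambda) lie in the spectrum because the vector whose coefficients are
    the conjugates of the lambda_w is a common eigenvector of the adjoints, which excludes a lower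
    bound for the sum of the X_j X_j^*. *)

Section ComplexLimits.
Variable R : realType.
Local Notation C := R[i].
Local Notation nc := (@Normc.normc R).
Local Notation Re := (@complex.Re R).
Local Notation Im := (@complex.Im R).

Lemma nc_ge0 (z : C) : 0 <= nc z.
Proof. by case: z => a b; exact: sqrtr_ge0. Qed.

Lemma normCE (z : C) : `|z| = (nc z)%:C.
Proof. by rewrite normc_def; case: z. Qed.

Lemma nc_real (a : R) : nc a%:C = `|a|.
Proof. by rewrite /= expr0n addr0 sqrtr_sqr. Qed.

Lemma ncJ (z : C) : nc z^* = nc z.
Proof. by case: z => a b /=; rewrite sqrrN. Qed.

Lemma mulCJ (z : C) : z * z^* = (nc z ^+ 2)%:C.
Proof. by rewrite -sqr_normc normCE rmorphXn. Qed.

Lemma cJ_real (a : R) : (a%:C)^* = a%:C :> C.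
Proof. by apply/eqP; rewrite eq_complex /= oppr0 !eqxx. Qed.

Lemma cJ0 : 0^* = 0 :> C. Proof. exact: (cJ_real 0). Qed.
Lemma cJ1 : 1^* = 1 :> C. Proof. exact: (cJ_real 1). Qed.
Lemma cJK (x : C) : x^*^* = x. Proof. exact: (@conjcK R). Qed.
Lemma cJN (x : C) : (- x)^* = - x^*. Proof. exact: (rmorphN (@conjc R)). Qed.
Lemma cJD (x y : C) : (x + y)^* = x^* + y^*.
Proof. exact: (rmorphD (@conjc R)). Qed.
Lemma cJM (x y : C) : (x * y)^* = x^* * y^*.
Proof. exact: (rmorphM (@conjc R)). Qed.
Lemma cJ_sum (I : Type) (s : seq I) (P : pred I) (F : I -> C) :
  (\sum_(i <- s | P i) F i)^* = \sum_(i <- s | P i) (F i)^*.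
Proof. exact: (rmorph_sum (@conjc R)). Qed.

Lemma ncN (z : C) : nc (- z) = nc z.
Proof. by case: z => a b /=; rewrite !sqrrN. Qed.

Lemma ncD (z w : C) : nc (z + w) <= nc z + nc w.
Proof. exact: le_normcD. Qed.

Lemma nc_le_ReIm (z : C) : nc z <= `|Re z| + `|Im z|.
Proof.
rewrite -ler_sqr ?nnegrE ?nc_ge0 ?addr_ge0// normc_sqr sqrrD !(real_normK (num_real _)).
by rewrite lerD2r lerDl mulrn_wge0// mulr_ge0.
Qed.

Lemma Re_le_nc (z : C) : `|Re z| <= nc z.
Proof. by rewrite -ler_sqr ?nnegrE ?nc_ge0// normc_sqr (real_normK (num_real _)) lerDl sqr_ge0. Qed.

Lemma Im_le_nc (z : C) : `|Im z| <= nc z.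
Proof. by rewrite -ler_sqr ?nnegrE ?nc_ge0// normc_sqr (real_normK (num_real _)) lerDr sqr_ge0. Qed.

Lemma ReJ (z : C) : Re z^* = Re z. Proof. by case: z. Qed.

Lemma ReD (x y : C) : Re (x + y) = Re x + Re y.
Proof. by case: x; case: y. Qed.

Lemma ImD (x y : C) : Im (x + y) = Im x + Im y.
Proof. by case: x; case: y. Qed.

Lemma ReN (x : C) : Re (- x) = - Re x.
Proof. by case: x. Qed.

Lemma ImN (x : C) : Im (- x) = - Im x.
Proof. by case: x. Qed.

Lemma Re_mulC (a : R) (x : C) : Re (a%:C * x) = a * Re x.
Proof. by case: x => c d /=; rewrite mul0r subr0. Qed.

Lemma Re_sum (I : Type) (s : seq I) (P : pred I) (F : I -> C) :
  Re (\sum_(i <- s | P i) F i) = \sum_(i <- s | P i) Re (F i).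
Proof. exact: (big_morph _ ReD). Qed.

Lemma Im_sum (I : Type) (s : seq I) (P : pred I) (F : I -> C) :
  Im (\sum_(i <- s | P i) F i) = \sum_(i <- s | P i) Im (F i).
Proof. exact: (big_morph _ ImD). Qed.

Lemma nc_sum (I : Type) (s : seq I) (P : pred I) (F : I -> C) :
  nc (\sum_(i <- s | P i) F i) <= \sum_(i <- s | P i) nc (F i).
Proof.
elim/big_ind2: _ => [|x a y b xa yb|//]; first by rewrite Normc.normc0.
exact: le_trans (ncD a b) (lerD xa yb).
Qed.

Lemma gt0_complex (e : C) : 0 < e -> exists2 r : R, 0 < r & e = r%:C.
Proof.
case: e => a b; rewrite ltcE /= => /andP[/eqP -> a0].
by exists a.
Qed.

Lemma cvg_complex (T : Type) (F : set_system T) {FF : Filter F}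
    (u : T -> C^o) (a b : R) :
  Re \o u @ F --> a -> Im \o u @ F --> b ->
  u @ F --> (a +i* b : C^o).
Proof.
move=> ua ub; apply/cvgrPdist_lt => e /gt0_complex[r r0 ->].
have r2 : 0 < r / 2 by rewrite divr_gt0.
have /cvgrPdist_lt/(_ _ r2) na := ua; have /cvgrPdist_lt/(_ _ r2) nb := ub.
near=> n; rewrite normCE ltcR.
apply: le_lt_trans (nc_le_ReIm _) _; rewrite (splitr r) ReD ImD ReN ImN.
by apply: ltrD; [near: n; exact: na|near: n; exact: nb].
Unshelve. all: by end_near. Qed.

Lemma cvg_Re (T : Type) (F : set_system T) {FF : Filter F}
    (u : T -> C^o) (l : C^o) :
  u @ F --> l -> Re \o u @ F --> Re l.
Proof.
move=> ul; apply/cvgrPdist_lt => e e0.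
have e0' : 0 < e%:C by rewrite ltcR.
have /cvgrPdist_lt/(_ _ e0') nl := ul.
near=> n; rewrite -ReN -ReD; apply: le_lt_trans (Re_le_nc _) _.
by rewrite -ltcR -normCE; near: n; exact: nl.
Unshelve. all: by end_near. Qed.

Lemma cvg_Im (T : Type) (F : set_system T) {FF : Filter F}
    (u : T -> C^o) (l : C^o) :
  u @ F --> l -> Im \o u @ F --> Im l.
Proof.
move=> ul; apply/cvgrPdist_lt => e e0.
have e0' : 0 < e%:C by rewrite ltcR.
have /cvgrPdist_lt/(_ _ e0') nl := ul.
near=> n; rewrite -ImN -ImD; apply: le_lt_trans (Im_le_nc _) _.
by rewrite -ltcR -normCE; near: n; exact: nl.
Unshelve. all: by end_near. Qed.

Lemma cvg_conj (T : Type) (F : set_system T) {FF : Filter F}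
    (u : T -> C^o) (l : C^o) :
  u @ F --> l -> (fun t => (u t)^* : C^o) @ F --> (l^* : C^o).
Proof.
move=> ul; have -> : l^* = Re l +i* - Im l by case: l {ul}.
apply: cvg_complex.
  rewrite (_ : _ \o _ = Re \o u); first exact: (cvg_Re ul).
  by apply/funext => t; rewrite /= ReJ.
rewrite (_ : _ \o _ = - (Im \o u)); first exact: cvgN (cvg_Im ul).
by apply/funext => t; rewrite -[RHS]/(- Im (u t)) /=; case: (u t).
Qed.

(** Multiplying by a phase turns a modulus into a real part, so bounds on real parts of linear
    expressions pass to moduli. *)
Lemma nc_le_Re (z : C) : exists2 c : C, nc c <= 1 & Re (c * z) = nc z.
Proof.
have [->|z0] := eqVneq (nc z) 0.
  by exists 0; rewrite ?Normc.normc0// mul0r.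
exists ((nc z)^-1%:C * z^*).
  by rewrite Normc.normcM ncJ nc_real ger0_norm ?invr_ge0 ?nc_ge0// mulVf.
by rewrite -mulrA [_^* * _]mulrC mulCJ -rmorphM/= expr2 mulrA mulVf// mul1r.
Qed.

End ComplexLimits.

(** * Finite sums over words of bounded length *)

Section Words.
Variable n : nat.
Local Notation word := (seq 'I_n).

(** A list rather than a finite type, so that one summation range can be reindexed by length, by
    first letter or by last letter. *)
Definition words (m : nat) : seq word :=
  flatten [seq [seq tval w | w <- index_enum (j.-tuple 'I_n)] | j <- index_iota 0 m.+1].

Lemma big_words (V : nmodType) m (F : word -> V) :
  \sum_(w <- words m) F w = \sum_(0 <= j < m.+1) \sum_(w : j.-tuple 'I_n) F w.
Proof.
rewrite big_flatten big_map; apply: eq_bigr => j _.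
by rewrite big_map.
Qed.

Lemma mem_words m w : (w \in words m) = (size w <= m)%N.
Proof.
apply/flatten_mapP/idP => [[j]|wm].
  by rewrite mem_index_iota => /andP[_ jm] /mapP[u _ ->]; rewrite size_tuple.
exists (size w); first by rewrite mem_index_iota.
by apply/mapP; exists (in_tuple w); rewrite // mem_index_enum.
Qed.

Lemma uniq_words m : uniq (words m).
Proof.
rewrite /words; have := iota_uniq 0 m.+1; rewrite /index_iota subn0.
elim: (iota _ _) => //= j s IHs /andP[js us].
rewrite cat_uniq IHs// andbT map_inj_uniq ?index_enum_uniq; last exact: val_inj.
apply/hasPn => w /flatten_mapP[l ls /mapP[u _ ->]].
apply/negP => /mapP[v _ /(congr1 size)]; rewrite !size_tuple => jl.
by rewrite -jl ls in js.
Qed.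

Lemma perm_words_cons m :
  perm_eq (words m.+1) ([::] :: [seq i :: w | w <- words m, i <- index_enum 'I_n]).
Proof.
apply: uniq_perm; first exact: uniq_words.
  rewrite cons_uniq; apply/andP; split; first by apply/negP => /allpairsP[[w i] []].
  apply: allpairs_uniq; rewrite ?uniq_words ?index_enum_uniq//.
  by move=> [w i] [v j] _ _ /= [-> ->].
move=> w; rewrite inE mem_words.
case: w => [|i w] //=; rewrite ltnS -mem_words.
apply/idP/allpairsP => [wm|[[v j] /= [vm _ [_ ->]]]//].
by exists (w, i); split => //=; rewrite mem_index_enum.
Qed.

Lemma perm_words_rcons m :
  perm_eq (words m.+1) ([::] :: [seq rcons w i | w <- words m, i <- index_enum 'I_n]).
Proof.
apply: uniq_perm; first exact: uniq_words.
  rewrite cons_uniq; apply/andP; split.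
    by apply/negP => /allpairsP[[w i] /= [_ _ /(congr1 size)]]; rewrite size_rcons.
  apply: allpairs_uniq; rewrite ?uniq_words ?index_enum_uniq//.
  by move=> [w i] [v j] _ _ /= /rcons_inj [-> ->].
move=> w; rewrite inE mem_words.
case/lastP: w => [|w i] //; rewrite size_rcons ltnS -mem_words.
have -> : (rcons w i == [::]) = false by case: w.
apply/idP/allpairsP => [wm|[[v j] /= [vm _ /rcons_inj[-> _]]]//].
by exists (w, i); split => //=; rewrite mem_index_enum.
Qed.

(** Peeling the first letter suits left creation and recursions on [i :: w]; [big_words_rcons] peels
    the last letter and suits right creation. *)
Lemma big_words_cons (V : nmodType) m (F : word -> V) :
  \sum_(w <- words m.+1) F w = F [::] + \sum_(w <- words m) \sum_i F (i :: w).
Proof. by rewrite (perm_big _ (perm_words_cons m)) big_cons big_allpairs_dep. Qed.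

Lemma big_words_rcons (V : nmodType) m (F : word -> V) :
  \sum_(w <- words m.+1) F w = F [::] + \sum_(w <- words m) \sum_i F (rcons w i).
Proof. by rewrite (perm_big _ (perm_words_rcons m)) big_cons big_allpairs_dep. Qed.

Lemma big_wordsD1 (V : nmodType) m v (F : word -> V) : (size v <= m)%N ->
  \sum_(w <- words m) F w = F v + \sum_(w <- words m | w != v) F w.
Proof. by move=> vm; rewrite (bigD1_seq v)//= ?mem_words// uniq_words. Qed.

Lemma big_words_only (V : nmodType) m v (F : word -> V) : (size v <= m)%N ->
  (forall w, w != v -> F w = 0) -> \sum_(w <- words m) F w = F v.
Proof. by move=> vm F0; rewrite (big_wordsD1 _ vm) big1 ?addr0. Qed.

Lemma big_words_trunc (V : nmodType) m p (F : word -> V) : (m <= p)%N ->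
  (forall w, (m < size w)%N -> F w = 0) ->
  \sum_(w <- words p) F w = \sum_(w <- words m) F w.
Proof.
move=> mp F0; rewrite (bigID (fun w => (size w <= m)%N))/= [X in _ + X]big1.
  rewrite addr0 -big_filter; apply/perm_big/uniq_perm => [||w].
  - exact/filter_uniq/uniq_words.
  - exact: uniq_words.
  - by rewrite mem_filter !mem_words; case: leqP => // wm; rewrite (leq_trans wm).
by move=> w; rewrite -ltnNge => /F0.
Qed.

End Words.

Lemma limn_ge_near (R : realFieldType) (u : nat -> R) (l M : R) :
  u @ \oo --> l -> (\forall m \near \oo, M <= u m) -> M <= l.
Proof.
move=> ul uM; rewrite -(cvg_lim (@Rhausdorff R) ul); apply: limr_ge => //.
by apply/cvg_ex; exists l.
Qed.

Lemma limn_le_near (R : realFieldType) (u : nat -> R) (l M : R) :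
  u @ \oo --> l -> (\forall m \near \oo, u m <= M) -> l <= M.
Proof.
move=> ul uM; rewrite -(cvg_lim (@Rhausdorff R) ul); apply: limr_le => //.
by apply/cvg_ex; exists l.
Qed.

(** * The Fock space as a Hilbert space *)

Section FockGeometry.
Variables (R : realType) (n : nat).
Local Notation C := R[i].
Local Notation nc := (@Normc.normc R).
Local Notation Re := (@complex.Re R).
Local Notation Im := (@complex.Im R).
Local Notation word := (seq 'I_n).
Local Notation F2 := (fock R n).
Implicit Types (x y z h : F2) (v w : word) (a : C).

Lemma fockE x y : (forall w, x w = y w) -> x = y.
Proof. by move=> xy; apply: val_inj; apply/funext. Qed.

Lemma fvalD x y w : (x + y) w = x w + y w. Proof. by []. Qed.
Lemma fvalB x y w : (x - y) w = x w - y w. Proof. by []. Qed.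
Lemma fvalZ a x w : (a *: x) w = a * x w. Proof. by []. Qed.
Lemma fval0 w : (0 : F2) w = 0. Proof. by []. Qed.
Lemma fval_sum (I : Type) (s : seq I) (P : pred I) (F : I -> F2) w :
  (\sum_(i <- s | P i) F i) w = \sum_(i <- s | P i) F i w.
Proof. by apply: (big_morph (fun x : F2 => x w)). Qed.

Lemma evecE v w : evec R v w = if w == v then 1 else 0.
Proof. by rewrite -[LHS]/((w == v)%:R); case: eqP. Qed.
Lemma evec_neq v w : w != v -> evec R v w = 0.
Proof. by rewrite evecE; case: eqP. Qed.
Lemma evec_eq v : evec R v v = 1.
Proof. by rewrite evecE eqxx. Qed.

Definition sqsum (x : word -> C) m : R := \sum_(w <- words n m) nc (x w) ^+ 2.

Lemma sqsum_ge0 (x : word -> C) m : 0 <= sqsum x m.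
Proof. by apply: sumr_ge0 => w _; exact: sqr_ge0. Qed.

Lemma in_fock_bound (x : word -> C) (M : R) :
  (forall m, sqsum x m <= M) -> x \in @in_fock R n.
Proof.
move=> xM; apply/asboolP; apply: nondecreasing_is_cvgn.
  by apply: nondecreasing_series => k _ _; exact: sqnorm_deg_ge0.
exists M => _ [[|m] _ <-].
  rewrite /series /= big_geq//; exact: le_trans (sqsum_ge0 x 0) (xM 0%N).
by have := xM m; rewrite /sqsum big_words.
Qed.

Lemma cvg_sqsum x : sqsum x @ \oo --> limn (series (sqnorm_deg x)).
Proof.
case: x => x /= /asboolP xc.
have /cvg_ex[l xl] := xc; rewrite (cvg_lim _ xl)//.
move: xl; rewrite -(cvg_shiftS (series (sqnorm_deg x))).
by rewrite (_ : [sequence _]_n = sqsum x)//; apply/funext => m /=; rewrite /sqsum big_words.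
Qed.

(** Polarization, applied termwise: it reduces convergence of inner products to the square
    summability built into the Fock space. *)
Lemma Re_mulJ (a b : C) : Re (a * b^*) = (nc (a + b) ^+ 2 - nc a ^+ 2 - nc b ^+ 2) / 2.
Proof. by rewrite !normc_sqr; case: a b => a1 a2 [b1 b2] /=; field. Qed.

Lemma Im_mulJ (a b : C) : Im (a * b^*) = Re (a * ('i%C * b)^*).
Proof. by case: a b => a1 a2 [b1 b2] /=; ring. Qed.

Lemma cvg_Re_inner x y :
  (fun m => Re (\sum_(w <- words n m) x w * (y w)^*)) @ \oo -->
   (limn (series (sqnorm_deg (x + y))) - limn (series (sqnorm_deg x))
     - limn (series (sqnorm_deg y))) / 2.
Proof.
rewrite (_ : (fun m => _) = (fun m => (sqsum (x + y) m - sqsum x m - sqsum y m) / 2)).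
  by apply: cvgMl; apply: cvgB; [apply: cvgB|]; exact: cvg_sqsum.
apply/funext => m; rewrite Re_sum /sqsum -!sumrB mulr_suml.
by apply: eq_bigr => w _; rewrite Re_mulJ.
Qed.

Lemma cvg_inner x y :
  (fun m => \sum_(w <- words n m) x w * (y w)^* : C^o) @ \oo --> (inner x y : C^o).
Proof.
pose s m : C^o := \sum_(w <- words n m) x w * (y w)^*.
have [l sl] : exists l : C^o, s @ \oo --> l.
  eexists; apply: cvg_complex; first exact: cvg_Re_inner.
  rewrite (_ : _ \o _ = fun m => Re (\sum_(w <- words n m) x w * (('i%C *: y) w)^*)).
    exact: cvg_Re_inner.
  apply/funext => m; rewrite /= /s Re_sum Im_sum.
  by apply: eq_bigr => w _; rewrite Im_mulJ.
suff -> : inner x y = l by [].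
rewrite /inner /word_sum; apply: (@cvg_lim C^o (@norm_hausdorff _ C^o)).
rewrite -cvg_shiftS (_ : [sequence _]_n = s)//.
by apply/funext => m; rewrite /s big_words.
Qed.

Arguments cvg_inner : clear implicits.

(** Since [inner] is defined by a [limn], identities for it are obtained by identifying the limit of
    its partial sums. *)
Lemma inner_unique x y (l : C) :
  (fun m => \sum_(w <- words n m) x w * (y w)^* : C^o) @ \oo --> (l : C^o) ->
  inner x y = l.
Proof.
move=> xl; have hC := @norm_hausdorff _ C^o.
by rewrite -(cvg_lim hC (cvg_inner x y)); exact: (cvg_lim hC xl).
Qed.

Lemma innerDl x y z : inner (x + y) z = inner x z + inner y z.
Proof.
apply: inner_unique; rewrite (_ : (fun m => _) =
  (fun m => \sum_(w <- words n m) x w * (z w)^* + \sum_(w <- words n m) y w * (z w)^*)).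
  exact: (cvgD (cvg_inner x z) (cvg_inner y z)).
by apply/funext => m; rewrite -big_split; apply: eq_bigr => w _; rewrite fvalD mulrDl.
Qed.

Lemma innerZl a x z : inner (a *: x) z = a * inner x z.
Proof.
apply: inner_unique; rewrite (_ : (fun m => _) =
  (fun m => a * \sum_(w <- words n m) x w * (z w)^*)).
  by apply: (@cvgMr C _ _ _ (fun m => \sum_(w <- words n m) x w * (z w)^*)); exact: cvg_inner.
by apply/funext => m; rewrite mulr_sumr; apply: eq_bigr => w _; rewrite fvalZ mulrA.
Qed.

Lemma innerC x y : inner y x = (inner x y)^*.
Proof.
apply: inner_unique; rewrite (_ : (fun m => _) =
  (fun m => (\sum_(w <- words n m) x w * (y w)^*)^*)).
  exact: (cvg_conj (cvg_inner x y)).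
apply/funext => m; rewrite cJ_sum; apply: eq_bigr => w _.
by rewrite cJM cJK mulrC.
Qed.

Lemma innerNl x z : inner (- x) z = - inner x z.
Proof. by rewrite -scaleN1r innerZl mulN1r. Qed.
Lemma innerBl x y z : inner (x - y) z = inner x z - inner y z.
Proof. by rewrite innerDl innerNl. Qed.
Lemma inner0l z : inner 0 z = 0.
Proof. by rewrite -(scale0r 0) innerZl mul0r. Qed.
Lemma innerDr x y z : inner z (x + y) = inner z x + inner z y.
Proof. by rewrite innerC innerDl cJD -!innerC. Qed.
Lemma innerZr a x z : inner z (a *: x) = a^* * inner z x.
Proof. by rewrite innerC innerZl cJM -!innerC. Qed.
Lemma innerNr x z : inner z (- x) = - inner z x.
Proof. by rewrite innerC innerNl cJN -!innerC. Qed.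
Lemma innerBr x y z : inner z (x - y) = inner z x - inner z y.
Proof. by rewrite innerDr innerNr. Qed.
Lemma inner0r z : inner z 0 = 0.
Proof. by rewrite innerC inner0l cJ0. Qed.
Lemma inner_suml (I : Type) (s : seq I) (P : pred I) (F : I -> F2) z :
  inner (\sum_(i <- s | P i) F i) z = \sum_(i <- s | P i) inner (F i) z.
Proof. by elim/big_rec2: _ => [|i u v _ <-]; rewrite ?inner0l ?innerDl. Qed.
Lemma inner_sumr (I : Type) (s : seq I) (P : pred I) (F : I -> F2) z :
  inner z (\sum_(i <- s | P i) F i) = \sum_(i <- s | P i) inner z (F i).
Proof. by elim/big_rec2: _ => [|i u v _ <-]; rewrite ?inner0r ?innerDr. Qed.

Lemma inner_fin m x y : (forall w, (m < size w)%N -> x w * (y w)^* = 0) ->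
  inner x y = \sum_(w <- words n m) x w * (y w)^*.
Proof.
move=> xy0; apply: inner_unique; apply: cvg_near_cst.
near=> p; apply/esym; apply: esym; apply: big_words_trunc => //.
by near: p; exact: nbhs_infty_ge.
Unshelve. all: by end_near. Qed.

Lemma inner_evec x v : inner x (evec R v) = x v.
Proof.
have e0 w : w != v -> x w * (evec R v w)^* = 0.
  by move=> /evec_neq ->; rewrite cJ0 mulr0.
rewrite (@inner_fin (size v)).
  by rewrite (big_words_only (leqnn _) e0) evec_eq cJ1 mulr1.
by move=> w vw; apply: e0; apply: contraTneq vw => ->; rewrite ltnn.
Qed.

Lemma cvg_hnorm x : sqsum x @ \oo --> hnorm x ^+ 2.
Proof.
have xx : (fun m => Re (\sum_(w <- words n m) x w * (x w)^*)) = sqsum x.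
  by apply/funext => m; rewrite Re_sum; apply: eq_bigr => w _; rewrite mulCJ.
have xl : sqsum x @ \oo --> Re (inner x x) by rewrite -xx; exact: (cvg_Re (cvg_inner x x)).
rewrite sqr_sqrtr//; apply: (limn_ge_near xl).
by apply: nearW => m; exact: sqsum_ge0.
Qed.

Arguments cvg_hnorm : clear implicits.

Lemma hnorm_ge0 x : 0 <= hnorm x. Proof. exact: sqrtr_ge0. Qed.

Lemma inner_self x : inner x x = (hnorm x ^+ 2)%:C.
Proof.
have h : Re (inner x x) = hnorm x ^+ 2.
  apply: (cvg_unique _ _ (cvg_hnorm x)) => //.
  rewrite (_ : sqsum x = (fun m => Re (\sum_(w <- words n m) x w * (x w)^*))).
    exact: (cvg_Re (cvg_inner x x)).
  by apply/funext => m; rewrite Re_sum; apply: eq_bigr => w _; rewrite mulCJ.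
rewrite [LHS]complexE h (_ : Im _ = 0) ?mulr0 ?addr0//.
by have := innerC x x; case: (inner x x) => a b [] /= /eqP;
  rewrite -addr_eq0 -mulr2n mulrn_eq0 => /eqP.
Qed.

Lemma sqsum_mono (c : word -> C) m p : (m <= p)%N -> sqsum c m <= sqsum c p.
Proof.
move=> mp; pose F w := if (size w <= m)%N then nc (c w) ^+ 2 else 0.
have -> : sqsum c m = \sum_(w <- words n p) F w.
  rewrite (big_words_trunc mp) => [|w]; last by rewrite /F ltnNge => /negPf ->.
  rewrite /sqsum big_seq [RHS]big_seq; apply: eq_bigr => w.
  by rewrite mem_words /F => ->.
by apply: ler_sum => w _; rewrite /F; case: ifP => // _; exact: sqr_ge0.
Qed.

Lemma sqsum_le x m : sqsum x m <= hnorm x ^+ 2.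
Proof.
apply: (limn_ge_near (cvg_hnorm x)) => //; near=> p; apply: sqsum_mono.
by near: p; exact: nbhs_infty_ge.
Unshelve. all: by end_near. Qed.

Lemma hnorm_bound x (M : R) : (forall m, sqsum x m <= M) -> hnorm x ^+ 2 <= M.
Proof. by move=> xM; apply: (limn_le_near (cvg_hnorm x)); exact: nearW. Qed.

Lemma nc_fval_le x w : nc (x w) <= hnorm x.
Proof.
rewrite -ler_sqr ?nnegrE ?nc_ge0 ?hnorm_ge0//; apply: le_trans (sqsum_le x (size w)).
rewrite /sqsum (big_wordsD1 _ (leqnn _)) lerDl.
by apply: sumr_ge0 => v _; exact: sqr_ge0.
Qed.

Lemma hnorm_eq0 x : hnorm x = 0 -> x = 0.
Proof.
move=> x0; apply: fockE => w; apply: Normc.eq0_normc; apply/eqP.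
by rewrite eq_le nc_ge0 -x0 nc_fval_le.
Qed.

Lemma hnorm0 : hnorm (0 : F2) = 0.
Proof. by apply/eqP; rewrite -sqrf_eq0 -(inj_eq (@complexI R)) -inner_self inner0l. Qed.

Lemma sqr_hnormZ a x : hnorm (a *: x) ^+ 2 = nc a ^+ 2 * hnorm x ^+ 2.
Proof.
apply: (@complexI R); rewrite -inner_self innerZl innerZr mulrA mulCJ inner_self.
by rewrite -rmorphM.
Qed.

Lemma hnormZ a x : hnorm (a *: x) = nc a * hnorm x.
Proof.
apply/eqP; rewrite -(@eqrXn2 _ 2)// ?mulr_ge0 ?hnorm_ge0 ?nc_ge0//.
by rewrite sqr_hnormZ exprMn.
Qed.

Lemma hnormN x : hnorm (- x) = hnorm x.
Proof. by rewrite -scaleN1r hnormZ ncN Normc.normc1 mul1r. Qed.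

Lemma sqr_hnormD x y :
  hnorm (x + y) ^+ 2 = hnorm x ^+ 2 + 2 * Re (inner x y) + hnorm y ^+ 2.
Proof.
have := inner_self (x + y); rewrite innerDl !innerDr !inner_self (innerC x y).
move=> /(congr1 Re); rewrite !ReD ReJ /= => <-; ring.
Qed.

Lemma Re_inner_le x y : Re (inner x y) <= hnorm x * hnorm y.
Proof.
have [x0|x0] := eqVneq (hnorm x) 0.
  by rewrite (hnorm_eq0 x0) inner0l hnorm0 mul0r.
have [y0|y0] := eqVneq (hnorm y) 0.
  by rewrite (hnorm_eq0 y0) inner0r hnorm0 mulr0.
have xp : 0 < hnorm x by rewrite lt_neqAle eq_sym x0 hnorm_ge0.
have yp : 0 < hnorm y by rewrite lt_neqAle eq_sym y0 hnorm_ge0.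
(* Both vectors are rescaled to length |x||y|, so expanding the square gives the inequality
   multiplied by 2|x||y|. *)
have := sqr_ge0 (hnorm ((hnorm y)%:C *: x - (hnorm x)%:C *: y)).
rewrite sqr_hnormD hnormN !hnormZ !nc_real !ger0_norm ?hnorm_ge0//.
rewrite innerNr innerZl innerZr ReN cJ_real mulrA -rmorphM/= Re_mulC => H.
have xy := mulr_gt0 xp yp.
rewrite -(ler_pM2l xy); nra.
Qed.

Lemma CauchySchwarz x y : nc (inner x y) <= hnorm x * hnorm y.
Proof.
have [c c1 <-] := nc_le_Re (inner x y); rewrite -innerZl.
apply: le_trans (Re_inner_le _ _) _; rewrite hnormZ -mulrA ler_piMl//.
by rewrite mulr_ge0 ?hnorm_ge0.
Qed.

Lemma hnormD x y : hnorm (x + y) <= hnorm x + hnorm y.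
Proof.
rewrite -ler_sqr ?nnegrE ?addr_ge0 ?hnorm_ge0// sqr_hnormD sqrrD.
have := Re_inner_le x y; lra.
Qed.

Lemma hnorm_distD x y z : hnorm (x - z) <= hnorm (x - y) + hnorm (y - z).
Proof. by rewrite -[x - z](subrKA y) hnormD. Qed.

(** Accepts any coefficient function, since it is also applied to families whose square summability
    is still to be proved. *)
Definition trunc m (c : word -> C) : F2 := \sum_(w <- words n m) c w *: evec R w.

Lemma truncE m c w : trunc m c w = if (size w <= m)%N then c w else 0.
Proof.
have e0 v : v != w -> (c v *: evec R v) w = 0.
  by rewrite eq_sym => /evec_neq wv; rewrite fvalZ wv mulr0.
rewrite fval_sum; case: leqP => wm.
  by rewrite (big_words_only wm e0) fvalZ evec_eq mulr1.
rewrite big_seq big1// => v; rewrite mem_words => vm; apply: e0.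
by apply: contraTneq wm => <-; rewrite -leqNgt.
Qed.

Lemma sqr_hnorm_fin m x : (forall w, (m < size w)%N -> x w = 0) ->
  hnorm x ^+ 2 = sqsum x m.
Proof.
move=> x0; apply: (@complexI R); rewrite -inner_self (@inner_fin m) => [|w /x0 ->].
  by rewrite rmorph_sum/=; apply: eq_bigr => w _; rewrite mulCJ.
by rewrite mul0r.
Qed.

Lemma sqr_hnorm_trunc m c : hnorm (trunc m c) ^+ 2 = sqsum c m.
Proof.
rewrite (@sqr_hnorm_fin m) => [|w]; last by rewrite truncE ltnNge => /negPf ->.
by rewrite /sqsum big_seq [RHS]big_seq; apply: eq_bigr => w; rewrite mem_words truncE => ->.
Qed.

Lemma hnorm_trunc_le m x : hnorm (trunc m x) <= hnorm x.
Proof. by rewrite -ler_sqr ?nnegrE ?hnorm_ge0// sqr_hnorm_trunc sqsum_le. Qed.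

Lemma trunc_inner m x : inner (trunc m x) x = (sqsum x m)%:C.
Proof.
rewrite (@inner_fin m) => [|w]; last by rewrite truncE ltnNge => /negPf ->; rewrite mul0r.
rewrite rmorph_sum big_seq [RHS]big_seq; apply: eq_bigr => w.
by rewrite mem_words truncE => ->; rewrite mulCJ.
Qed.

(** By Pythagoras the squared error is [hnorm x ^+ 2 - sqsum x m], which tends to 0. *)
Lemma trunc_approx x (e : R) : 0 < e ->
  exists N, forall m, (N <= m)%N -> hnorm (x - trunc m x) < e.
Proof.
move=> e0; have e2 : 0 < e ^+ 2 by rewrite exprn_gt0.
have /cvgrPdist_lt/(_ _ e2)[N _ HN] := cvg_hnorm x.
exists N => m /HN; rewrite ger0_norm ?subr_ge0 ?sqsum_le// => H.
rewrite -ltr_sqr ?nnegrE ?hnorm_ge0 ?(ltW e0)// sqr_hnormD hnormN innerNr ReN.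
rewrite sqr_hnorm_trunc innerC trunc_inner cJ_real /=; lra.
Qed.

End FockGeometry.

(** * Bounded operators and adjoints *)

Section Operators.
Variables (R : realType) (n : nat).
Local Notation C := R[i].
Local Notation nc := (@Normc.normc R).
Local Notation Re := (@complex.Re R).
Local Notation word := (seq 'I_n).
Local Notation F2 := (fock R n).
Local Notation op := (F2 -> F2).
Implicit Types (x y z h : F2) (v w : word) (a : C) (T U : op).

Section Linear.
Variable T : op.
Hypothesis lT : linear T.

Lemma opD x y : T (x + y) = T x + T y.
Proof. by have := lT 1 x y; rewrite !scale1r. Qed.
Lemma op0 : T 0 = 0.
Proof. by apply: (addrI (T 0)); rewrite -opD !addr0. Qed.
Lemma opZ a x : T (a *: x) = a *: T x.
Proof. by have := lT a x 0; rewrite op0 !addr0. Qed.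
Lemma opN x : T (- x) = - T x.
Proof. by rewrite -scaleN1r opZ scaleN1r. Qed.
Lemma opB x y : T (x - y) = T x - T y.
Proof. by rewrite opD opN. Qed.
Lemma op_sum (I : Type) (s : seq I) (P : pred I) (F : I -> F2) :
  T (\sum_(i <- s | P i) F i) = \sum_(i <- s | P i) T (F i).
Proof. by elim/big_rec2: _ => [|i u v _ <-]; rewrite ?op0 ?opD. Qed.

End Linear.

Lemma bounded_pos T : bounded_op T ->
  exists2 M : R, 0 < M & forall x, hnorm (T x) <= M * hnorm x.
Proof.
case=> _ [M TM]; exists (`|M| + 1); first by rewrite ltr_wpDl.
move=> x; apply: le_trans (TM x) _; by rewrite ler_wpM2r ?hnorm_ge0// ler_wpDr// ler_norm.
Qed.

Lemma bounded_idop : bounded_op (@idop R n).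
Proof. by split=> //; exists 1 => x; rewrite mul1r. Qed.

Lemma bounded_comp T U : bounded_op T -> bounded_op U -> bounded_op (T \o U).
Proof.
move=> bT bU; split=> [a x y|] /=; first by rewrite bU.1 bT.1.
have [M M0 TM] := bounded_pos bT; have [N N0 UN] := bounded_pos bU.
exists (M * N) => x; apply: le_trans (TM _) _.
by rewrite -mulrA ler_wpM2l// ltW.
Qed.

Lemma bounded_lin a T U : bounded_op T -> bounded_op U -> bounded_op (a *: T + U).
Proof.
move=> bT bU; split=> [c x y|].
  rewrite -[LHS]/(a *: T (c *: x + y) + U (c *: x + y)).
  rewrite -[X in _ = c *: X + _]/(a *: T x + U x) -[X in _ = _ + X]/(a *: T y + U y).
  by rewrite bU.1 bT.1 !scalerDr !scalerA (mulrC c a) !addrA; congr (_ + _);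
    rewrite -!addrA; congr (_ + _); rewrite addrC.
have [M M0 TM] := bounded_pos bT; have [N N0 UN] := bounded_pos bU.
exists (nc a * M + N) => x; apply: le_trans (hnormD _ _) _.
by rewrite mulrDl; apply: lerD => //; rewrite hnormZ -mulrA ler_wpM2l ?nc_ge0.
Qed.

Lemma bounded_op0 : bounded_op (0 : op).
Proof.
split=> [a x y|]; first by rewrite -[LHS]/0 scaler0 addr0.
by exists 0 => x; rewrite -[_ x]/0 hnorm0 mul0r.
Qed.

Lemma bounded_opD T U : bounded_op T -> bounded_op U -> bounded_op (T + U).
Proof. by move=> bT bU; rewrite -[T]scale1r; exact: bounded_lin. Qed.

Lemma bounded_opZ a T : bounded_op T -> bounded_op (a *: T).
Proof. by move=> bT; rewrite -[_ *: _]addr0; apply: bounded_lin => //; exact: bounded_op0. Qed.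

Lemma bounded_opB T U : bounded_op T -> bounded_op U -> bounded_op (T - U).
Proof. by move=> bT bU; apply: bounded_opD => //; rewrite -scaleN1r; exact: bounded_opZ. Qed.

Lemma bounded_op_sum (I : Type) (s : seq I) (P : pred I) (F : I -> op) :
  (forall i, P i -> bounded_op (F i)) -> bounded_op (\sum_(i <- s | P i) F i).
Proof.
move=> bF; elim/big_ind: _ => //; [exact: bounded_op0|exact: bounded_opD].
Qed.

Lemma op_sumE (I : Type) (s : seq I) (P : pred I) (F : I -> op) x :
  (\sum_(i <- s | P i) F i) x = \sum_(i <- s | P i) F i x.
Proof. by elim/big_rec2: _ => [|i u v _ <-]. Qed.

Section Functional.
Variables (F : F2 -> C) (M : R).
Hypotheses (M0 : 0 <= M) (lF : forall a x y, F (a *: x + y) = a * F x + F y)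
  (FM : forall x, nc (F x) <= M * hnorm x).

Let F_D x y : F (x + y) = F x + F y.
Proof. by have := lF 1 x y; rewrite scale1r mul1r. Qed.
Let F_0 : F 0 = 0.
Proof. by apply: (addrI (F 0)); rewrite -F_D !addr0. Qed.
Let F_Z a x : F (a *: x) = a * F x.
Proof. by have := lF a x 0; rewrite F_0 !addr0. Qed.
Let F_sum (I : Type) (s : seq I) (P : pred I) (G : I -> F2) :
  F (\sum_(i <- s | P i) G i) = \sum_(i <- s | P i) F (G i).
Proof. by elim/big_rec2: _ => [|i u v _ <-]; rewrite ?F_0 ?F_D. Qed.

Lemma functional_eq0 : (forall w, F (evec R w) = 0) -> forall x, F x = 0.
Proof.
move=> F0 x; apply: Normc.eq0_normc; apply/eqP; rewrite eq_le nc_ge0 andbT.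
apply/ler_addgt0Pl => e e0; rewrite addr0.
(* [M] may be 0, hence the denominator [M + 1]. *)
have [|N /(_ _ (leqnn N)) xN] := @trunc_approx R n x (e / (M + 1)).
  by rewrite divr_gt0// ltr_wpDl.
rewrite -[x](subrK (trunc N x)) F_D [X in _ + X](_ : _ = 0) ?addr0.
  apply: le_trans (FM _) _; move: xN; rewrite ltr_pdivlMr ?ltr_wpDl// => xN.
  by apply: le_trans (ltW xN); rewrite mulrC ler_wpM2l ?hnorm_ge0// lerDl.
by rewrite F_sum big1// => w _; rewrite F_Z F0 mulr0.
Qed.

(** Evaluating [F] on the truncation of its own conjugate coefficients gives s^2 <= M s, where s is
    the norm of that truncation. *)
Lemma riesz_subproof m : sqsum (fun w => (F (evec R w))^*) m <= M ^+ 2.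
Proof.
set c := fun w => _; have := FM (trunc m c); rewrite -sqr_hnorm_trunc.
rewrite (_ : F _ = (sqsum c m)%:C); last first.
  rewrite /trunc F_sum rmorph_sum/=; apply: eq_bigr => w _.
  by rewrite F_Z mulrC -{1}[F _]cJK mulrC mulCJ.
rewrite nc_real -sqr_hnorm_trunc normrX ger0_norm ?hnorm_ge0//.
set s := hnorm _; have s0 : 0 <= s by exact: hnorm_ge0.
have [->|s1] := eqVneq s 0; first by rewrite expr0n sqr_ge0.
rewrite expr2 ler_pM2r ?lt_neqAle 1?eq_sym ?s1// => sM.
by rewrite ler_sqr.
Qed.

End Functional.

(** The representing vector has the conjugates of [F (evec R w)] as coefficients; both sides agree
    on the basis, hence everywhere by density. *)
Lemma riesz (F : F2 -> C) (M : R) : 0 <= M ->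
  (forall a x y, F (a *: x + y) = a * F x + F y) ->
  (forall x, nc (F x) <= M * hnorm x) ->
  exists2 y, hnorm y <= M & forall x, F x = inner x y.
Proof.
move=> M0 lF FM; pose y : F2 := Fock (in_fock_bound (riesz_subproof M0 lF FM)).
have yM : hnorm y <= M.
  rewrite -ler_sqr ?nnegrE ?hnorm_ge0//; apply: hnorm_bound.
  exact: (riesz_subproof M0 lF FM).
exists y => // x; apply/eqP; rewrite -subr_eq0; apply/eqP.
apply: (@functional_eq0 (fun x => F x - inner x y) (M + M)).
- by rewrite addr_ge0.
- by move=> a u v; rewrite lF innerDl innerZl mulrBr opprD addrACA.
- move=> u; apply: le_trans (ncD _ _) _; rewrite ncN mulrDl; apply: lerD => //.
  apply: le_trans (CauchySchwarz _ _) _; by rewrite mulrC ler_wpM2r ?hnorm_ge0.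
- move=> w; rewrite innerC inner_evec -[y w]/((F (evec R w))^*) cJK subrr.
  by [].
Qed.

Lemma op_ext T U : bounded_op T -> bounded_op U ->
  (forall w, T (evec R w) = U (evec R w)) -> T = U.
Proof.
move=> bT bU TU; apply/funext => x; apply/eqP; rewrite -subr_eq0; apply/eqP.
have bTU := bounded_opB bT bU; have [M M0 TUM] := bounded_pos bTU.
apply: fockE => w; rewrite -[_ w]/((T - U) x w).
apply: (@functional_eq0 (fun x => (T - U) x w) M (ltW M0)).
- by move=> a u v; rewrite bTU.1.
- by move=> u; apply: le_trans (TUM u); exact: nc_fval_le.
- by move=> v; rewrite -[LHS]/(T (evec R v) w - U (evec R v) w) TU subrr.
Qed.

(** Sharpens the constant of an operator already known to be bounded: truncations approximate [x]
    without increasing its norm. *)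
Lemma hnorm_density T (M : R) x : bounded_op T -> 0 <= M ->
  (forall p, hnorm (T (trunc p x)) <= M * hnorm (trunc p x)) ->
  hnorm (T x) <= M * hnorm x.
Proof.
move=> bT M0 TM; apply/ler_addgt0Pl => e e0; have [K K0 TK] := bounded_pos bT.
have [|N /(_ _ (leqnn N)) xN] := @trunc_approx R n x (e / K); first by rewrite divr_gt0.
rewrite -[x in T x](subrK (trunc N x)) (opD bT.1).
apply: le_trans (hnormD _ _) _; apply: lerD.
  by apply: le_trans (TK _) _; rewrite mulrC -ler_pdivlMr// ltW.
by apply: le_trans (TM N) _; rewrite ler_wpM2l// hnorm_trunc_le.
Qed.

Lemma inner_ext y z : (forall x, inner x y = inner x z) -> y = z.
Proof.
move=> yz; apply: fockE => w; apply: (inv_inj (@cJK R)).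
by rewrite -!inner_evec -!innerC yz.
Qed.

(** Discharges the [xget] in [adjoint]: Riesz applied to x |-> <T x, y> gives the values, and
    uniqueness of the representing vector gives linearity. *)
Lemma adjoint_spec T : bounded_op T ->
  bounded_op (adjoint T) /\ forall x y, inner (T x) y = inner x (adjoint T y).
Proof.
move=> bT; suff TE : exists T', bounded_op T' /\
    forall x y, inner (T x) y = inner x (T' y) by exact: (xgetPex 0 TE).
have [M M0 TM] := bounded_pos bT.
have H y : exists z, hnorm z <= M * hnorm y /\ forall x, inner (T x) y = inner x z.
  have [|||z zM zE] := @riesz (fun x => inner (T x) y) (M * hnorm y).
  - by rewrite mulr_ge0 ?hnorm_ge0// ltW.
  - by move=> a u v; rewrite bT.1 innerDl innerZl.
  - move=> x; apply: le_trans (CauchySchwarz _ _) _.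
    by rewrite mulrAC ler_wpM2r ?hnorm_ge0.
  by exists z.
have [T' T'E] := choice H; exists T'; split; last by move=> x y; exact: (T'E y).2.
split; last by exists M => y; exact: (T'E y).1.
move=> a u v; apply: inner_ext => x.
by rewrite -(T'E _).2 innerDr innerZr !(T'E _).2 innerDr innerZr.
Qed.

Lemma adjointE T x y : bounded_op T -> inner (T x) y = inner x (adjoint T y).
Proof. by case/adjoint_spec. Qed.

Lemma adjointEr T x y : bounded_op T -> inner (adjoint T y) x = inner y (T x).
Proof. by move=> bT; rewrite innerC -adjointE// -innerC. Qed.

Lemma bounded_adjoint T : bounded_op T -> bounded_op (adjoint T).
Proof. by case/adjoint_spec. Qed.

End Operators.

(** * Right creation operators and their commutant *)

Section Shifts.
Variables (R : realType) (n : nat).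
Local Notation C := R[i].
Local Notation nc := (@Normc.normc R).
Local Notation word := (seq 'I_n).
Local Notation F2 := (fock R n).
Local Notation op := (F2 -> F2).
Implicit Types (x y z h : F2) (v w : word) (a : C) (T U : op) (i j : 'I_n).

Definition rcreation_fun i x : word -> C := fun w =>
  if w is j :: w' then (if last j w' == i then x (belast j w') else 0) else 0.

Lemma rcreation_fun_rcons i x w j :
  rcreation_fun i x (rcons w j) = if j == i then x w else 0.
Proof. by case: w => [|k w] //=; rewrite last_rcons belast_rcons. Qed.

Lemma sqsum_rcreation i x m : sqsum (rcreation_fun i x) m.+1 = sqsum x m.
Proof.
rewrite /sqsum big_words_rcons Normc.normc0 expr0n add0r; apply: eq_bigr => w _.
rewrite (bigD1 i)//= rcreation_fun_rcons eqxx big1 ?addr0// => j /negPf ji.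
by rewrite rcreation_fun_rcons ji Normc.normc0 expr0n.
Qed.

Lemma rcreation_bound i x m : sqsum (rcreation_fun i x) m <= hnorm x ^+ 2.
Proof.
by apply: le_trans (sqsum_mono _ (leqnSn m)) _; rewrite sqsum_rcreation sqsum_le.
Qed.

Definition rcreation i x : F2 := Fock (in_fock_bound (rcreation_bound i x)).

Arguments rcreation : simpl never.

Lemma rcreation_rcons i x w j : rcreation i x (rcons w j) = if j == i then x w else 0.
Proof. exact: rcreation_fun_rcons. Qed.

Lemma rcreation_nil i x : rcreation i x [::] = 0. Proof. by []. Qed.

Lemma rannihil_bound i x m : sqsum (fun w => x (rcons w i)) m <= hnorm x ^+ 2.
Proof.
apply: le_trans (sqsum_le x m.+1); rewrite /sqsum big_words_rcons.
rewrite ler_wpDl ?sqr_ge0//; apply: ler_sum => w _.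
by rewrite (bigD1 i)//= lerDl sumr_ge0// => j _; exact: sqr_ge0.
Qed.

Definition rannihil i x : F2 := Fock (in_fock_bound (rannihil_bound i x)).

Arguments rannihil : simpl never.

Lemma rannihilE i x w : rannihil i x w = x (rcons w i). Proof. by []. Qed.

Lemma bounded_rcreation i : bounded_op (rcreation i).
Proof.
split=> [a x y|].
  apply: fockE; case/lastP => [|w j].
    by rewrite fvalD fvalZ !rcreation_nil mulr0 addr0.
  rewrite fvalD fvalZ !rcreation_rcons; case: ifP => // _.
  by rewrite mulr0 addr0.
exists 1 => x; rewrite mul1r -ler_sqr ?nnegrE ?hnorm_ge0//.
exact/hnorm_bound/rcreation_bound.
Qed.

Lemma hnorm_rannihil i x : hnorm (rannihil i x) <= hnorm x.
Proof.
rewrite -ler_sqr ?nnegrE ?hnorm_ge0//.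
exact/hnorm_bound/rannihil_bound.
Qed.

Lemma bounded_rannihil i : bounded_op (rannihil i).
Proof.
split=> [a x y|]; first exact: fockE.
by exists 1 => x; rewrite mul1r hnorm_rannihil.
Qed.

Lemma inner_rcreation i x y : inner (rcreation i x) y = inner x (rannihil i y).
Proof.
apply: inner_unique; rewrite -cvg_shiftS.
rewrite (_ : [sequence _]_n =
    (fun m => \sum_(w <- words n m) x w * (rannihil i y w)^*)); first exact: cvg_inner.
apply/funext => m; rewrite [LHS]big_words_rcons rcreation_nil mul0r add0r.
apply: eq_bigr => w _; rewrite (bigD1 i)// rcreation_rcons eqxx big1; first exact: addr0.
by move=> j /negPf ji; rewrite rcreation_rcons ji mul0r.
Qed.

Lemma rcreation_evec i w : rcreation i (evec R w) = evec R (rcons w i).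
Proof.
apply: fockE; case/lastP => [|v j].
  by rewrite rcreation_nil evec_neq//; case: w.
by rewrite rcreation_rcons !evecE eqseq_rcons andbC; case: (j == i).
Qed.

(** The right creations have orthogonal ranges that together miss only the vacuum; this is the
    source of the rank-one terms in [gram_sum]. *)
Lemma sum_rcreation_rannihil x :
  \sum_i rcreation i (rannihil i x) = x - x [::] *: evec R [::].
Proof.
apply: fockE; case/lastP => [|v j]; rewrite fval_sum fvalB fvalZ.
  by rewrite evec_eq mulr1 subrr big1.
rewrite evec_neq ?mulr0 ?subr0; last by case: v.
rewrite (bigD1 j)// rcreation_rcons eqxx rannihilE big1; first exact: addr0.
by move=> i /negPf ij; rewrite rcreation_rcons eq_sym ij.
Qed.

Lemma creation_evec i w : creation i (evec R w) = evec R (i :: w).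
Proof.
apply: fockE => -[|j v]; first by rewrite evec_neq.
rewrite -[LHS]/(if j == i then evec R w v else 0) !evecE eqseq_cons.
by case: (j == i).
Qed.

Lemma creation_bound i x m : sqsum (creation i x) m <= hnorm x ^+ 2.
Proof.
apply: le_trans (sqsum_mono _ (leqnSn m)) _; apply: le_trans (sqsum_le x m).
rewrite /sqsum big_words_cons Normc.normc0 expr0n add0r; apply: ler_sum => w _.
rewrite (bigD1 i)//= eqxx big1 ?addr0// => j /negPf ->.
by rewrite Normc.normc0 expr0n.
Qed.

Lemma bounded_creation i : bounded_op (@creation R n i).
Proof.
split=> [a x y|].
  apply: fockE => -[|j w]; first by rewrite -[RHS]/(a * 0 + 0) mulr0 addr0.
  rewrite fvalD fvalZ /=; case: ifP => // _.
  by rewrite mulr0 addr0.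
exists 1 => x; rewrite mul1r -ler_sqr ?nnegrE ?hnorm_ge0//.
exact/hnorm_bound/creation_bound.
Qed.

Definition rcreations v x := foldl (fun x i => rcreation i x) x v.
Definition rannihils v x := foldr rannihil x v.

Lemma rannihilsE v x w : rannihils v x w = x (w ++ v).
Proof.
elim: v w => [|i v IH] w; first by rewrite cats0.
by rewrite -[LHS]/(rannihil i (rannihils v x) w) rannihilE IH cat_rcons.
Qed.

Lemma inner_rcreations v x y : inner (rcreations v x) y = inner x (rannihils v y).
Proof.
elim: v x => [|i v IH] x //=; rewrite /rcreations /=.
by rewrite -inner_rcreation -IH.
Qed.

Lemma rcreations_rcons v i x : rcreations (rcons v i) x = rcreation i (rcreations v x).
Proof. by rewrite /rcreations foldl_rcons. Qed.

Lemma rcreations_evec v w : rcreations v (evec R w) = evec R (w ++ v).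
Proof.
elim/last_ind: v => [|v i IH]; first by rewrite cats0.
by rewrite rcreations_rcons IH rcreation_evec rcons_cat.
Qed.

Lemma bounded_rannihils v : bounded_op (rannihils v).
Proof.
elim: v => [|i v IH]; first exact: bounded_idop.
exact: bounded_comp (bounded_rannihil i) IH.
Qed.

Definition rcommutant (T : op) : Prop :=
  bounded_op T /\ forall i x, T (rcreation i x) = rcreation i (T x).

Lemma rcommutant_rcreations T v x : rcommutant T ->
  T (rcreations v x) = rcreations v (T x).
Proof.
move=> [_ cT]; elim/last_ind: v => [|v i IH] //.
by rewrite !rcreations_rcons cT IH.
Qed.

(** An element of the commutant is determined by its symbol [T (evec R [::])], which lists its
    Fourier coefficients. *)
Lemma rcommutant_evec T w : rcommutant T ->
  T (evec R w) = rcreations w (T (evec R [::])).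
Proof. by move=> cT; rewrite -rcommutant_rcreations// rcreations_evec. Qed.

Lemma rcommutant_ext T U : rcommutant T -> rcommutant U ->
  T (evec R [::]) = U (evec R [::]) -> T = U.
Proof.
move=> cT cU TU; apply: op_ext; [exact: cT.1|exact: cU.1|move=> w].
by rewrite (rcommutant_evec w cT) (rcommutant_evec w cU) TU.
Qed.

Lemma rcommutant_idop : rcommutant (@idop R n).
Proof. by split => //; exact: bounded_idop. Qed.

Lemma rcommutant_lin a T U : rcommutant T -> rcommutant U -> rcommutant (a *: T + U).
Proof.
move=> [bT cT] [bU cU]; split; first exact: bounded_lin.
move=> i x; rewrite -[LHS]/(a *: T (rcreation i x) + U (rcreation i x)) cT cU.
by rewrite -(bounded_rcreation i).1.
Qed.

Lemma rcommutant_comp T U : rcommutant T -> rcommutant U -> rcommutant (T \o U).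
Proof.
move=> [bT cT] [bU cU]; split; first exact: bounded_comp.
by move=> i x /=; rewrite cU cT.
Qed.

Lemma rcommutant_creation i : rcommutant (@creation R n i).
Proof.
split; first exact: bounded_creation.
move=> j x; rewrite -[LHS]/((creation i \o rcreation j) x) -[RHS]/((rcreation j \o creation i) x).
congr (_ x); apply: op_ext => [||w].
- exact: bounded_comp (bounded_creation i) (bounded_rcreation j).
- exact: bounded_comp (bounded_rcreation j) (bounded_creation i).
- by rewrite /= rcreation_evec !creation_evec rcreation_evec.
Qed.

Lemma op_algebra_rcommutant : op_algebra rcommutant.
Proof.
split; [by move=> T []| |exact: rcommutant_comp].
by move=> a T U; exact: rcommutant_lin.
Qed.

Lemma innerT_eq T U x y : inner ((T - U) x) y = inner (T x) y - inner (U x) y.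
Proof. exact: innerBl. Qed.

(** Commutation compares the matrix entry of [T] at (R_i x, y) with the one at (x, R_i^* y), and one
    weak neighbourhood controls both. *)
Lemma wot_closed_rcommutant : wot_closed rcommutant.
Proof.
move=> T bT Tapp; split=> // i x; apply/eqP; rewrite -subr_eq0; apply/eqP.
apply: fockE => w; rewrite fval0 -inner_evec innerBl inner_rcreation.
set y := evec R w; apply: Normc.eq0_normc; apply/eqP; rewrite eq_le nc_ge0 andbT.
apply/ler_addgt0Pl => e e0; rewrite addr0.
have [|X [bX cX] XT] := Tapp [:: (rcreation i x, y); (x, rannihil i y)] (e / 2).
  by rewrite divr_gt0.
have := XT _ (mem_head _ _); have := XT (x, rannihil i y).
rewrite !inE eqxx orbT => /(_ isT) /=; rewrite !innerT_eq cX inner_rcreation.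
rewrite !normCE !ltcR => H1 H2.
rewrite (splitr e) -[X in X - _](subrK (inner (X x) (rannihil i y))) -addrA.
apply: le_trans (ncD _ _) _; apply: lerD; first exact: ltW.
by rewrite -opprB ncN ltW.
Qed.

Lemma Finfty_rcommutant T : Finfty T -> rcommutant T.
Proof.
apply; [exact: op_algebra_rcommutant|exact: wot_closed_rcommutant| |].
  exact: rcommutant_idop.
exact: rcommutant_creation.
Qed.

Lemma Finfty_lin a T U : Finfty T -> Finfty U -> Finfty (a *: T + U).
Proof.
move=> FT FU A Aalg Awot A1 AS; case: (Aalg) => _ Alin _.
by apply: Alin; [exact: FT|exact: FU].
Qed.

Lemma Finfty_comp T U : Finfty T -> Finfty U -> Finfty (T \o U).
Proof.
move=> FT FU A Aalg Awot A1 AS; case: (Aalg) => _ _ Acomp.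
by apply: Acomp; [exact: FT|exact: FU].
Qed.

Lemma Finfty_idop : Finfty (@idop R n). Proof. by []. Qed.

Lemma Finfty_creation i : Finfty (@creation R n i). Proof. by []. Qed.

Lemma Finfty0 : Finfty (0 : op).
Proof.
rewrite -[0](subrr (@idop R n)) addrC -scaleN1r.
exact: Finfty_lin Finfty_idop Finfty_idop.
Qed.

Lemma FinftyZ a T : Finfty T -> Finfty (a *: T).
Proof. by move=> FT; rewrite -[_ *: _]addr0; exact: Finfty_lin FT Finfty0. Qed.

Lemma FinftyD T U : Finfty T -> Finfty U -> Finfty (T + U).
Proof. by move=> FT FU; rewrite -[T]scale1r; exact: Finfty_lin. Qed.

Lemma Finfty_sum (I : Type) (s : seq I) (P : pred I) (F : I -> op) :
  (forall t, P t -> Finfty (F t)) -> Finfty (\sum_(t <- s | P t) F t).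
Proof. by move=> FF; elim/big_ind: _ => //; [exact: Finfty0|exact: FinftyD]. Qed.

End Shifts.

(** * Cesaro means *)

Section Cesaro.
Variables (R : realType) (n : nat).
Local Notation C := R[i].
Local Notation nc := (@Normc.normc R).
Local Notation word := (seq 'I_n).
Local Notation F2 := (fock R n).
Local Notation op := (F2 -> F2).
Implicit Types (x y z h : F2) (v w : word) (a : C) (T U : op) (i j : 'I_n).

Lemma op_scaleE a T x : (a *: T) x = a *: T x. Proof. by []. Qed.

Lemma rannihils_evec_cat v w : rannihils v (evec R (w ++ v)) = evec R w.
Proof.
apply: fockE => u; rewrite rannihilsE !evecE.
have [->|uw] := eqVneq u w; first by rewrite eqxx.
case: eqP => // e; have /addIn sz : (size u + size v = size w + size v)%N.
  by rewrite -!size_cat e.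
by move/eqP: e; rewrite eqseq_cat// (negPf uw).
Qed.

Lemma rcreations_cat v x w : rcreations v x (w ++ v) = x w.
Proof. by rewrite -inner_evec inner_rcreations rannihils_evec_cat inner_evec. Qed.

Lemma rcreations_eq0 v x w : (forall u, w != u ++ v) -> rcreations v x w = 0.
Proof.
move=> wv; rewrite -inner_evec inner_rcreations (_ : rannihils v _ = 0) ?inner0r//.
by apply: fockE => u; rewrite rannihilsE evec_neq// eq_sym.
Qed.

Lemma suffix_dec v w : (exists u, w = u ++ v) \/ forall u, w != u ++ v.
Proof.
have [/eqP wv|wv] := boolP (drop (size w - size v) w == v).
  left; exists (take (size w - size v) w).
  by rewrite -[in LHS](cat_take_drop (size w - size v) w) wv.
by right=> u; apply: contra_neq wv => ->; rewrite size_cat addnK drop_size_cat.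
Qed.

Definition creations w x := foldr (@creation R n) x w.

Lemma creations_evec w v : creations w (evec R v) = evec R (w ++ v).
Proof. by elim: w => [|i w IH] //=; rewrite IH creation_evec. Qed.

Lemma Finfty_creations w : Finfty (creations w).
Proof.
elim: w => [|i w IH]; first exact: Finfty_idop.
exact: Finfty_comp (Finfty_creation i) IH.
Qed.

(** Counts the windows that contain a given range of lengths; truncated subtraction yields 0 once
    the lengths are too far apart. *)
Lemma count_window (a b K : nat) :
  (\sum_(s < K) (a <= s <= b) = minn K b.+1 - a)%N.
Proof.
elim: K => [|K IH]; first by rewrite big_ord0 min0n.
by rewrite big_ord_recr /= IH; lia.
Qed.

Section Means.
Variables (T : op) (m : nat).
Hypothesis cT : rcommutant T.

Let ratio (w : word) : R := (m.+1 - size w)%:R / m.+1%:R.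

(** Fejer weights are used because plain partial sums of the Fourier series need not be uniformly
    bounded in norm. *)
Definition cesaro : op :=
  \sum_(w <- words n m) ((ratio w)%:C * T (evec R [::]) w) *: creations w.

Lemma Finfty_cesaro : Finfty cesaro.
Proof. by apply: Finfty_sum => w _; apply: FinftyZ; exact: Finfty_creations. Qed.

(** Both operators send e_v into the span of words [u ++ v], so only the length of [u] matters; at
    all other words both sides vanish. *)
Lemma cesaro_evec v w :
  cesaro (evec R v) w = ((m.+1 - (size w - size v))%:R / m.+1%:R)%:C * T (evec R v) w.
Proof.
rewrite (rcommutant_evec _ (Finfty_rcommutant Finfty_cesaro)) (rcommutant_evec _ cT).
have [[u ->]|wv] := suffix_dec v w; last by rewrite !rcreations_eq0// mulr0.
rewrite !rcreations_cat size_cat addnK /cesaro op_sumE.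
rewrite (_ : \sum_(w0 <- _) _ = trunc m (fun u => (ratio u)%:C * T (evec R [::]) u)).
  rewrite truncE; case: leqP => um //; rewrite (_ : m.+1 - size u = 0)%N ?mul0r//.
  by apply/eqP; rewrite subn_eq0.
by apply: eq_bigr => t _; rewrite op_scaleE creations_evec cats0.
Qed.

(** Keeps the lengths from s - m to s; writing [s <= size w + m] avoids truncated subtraction for
    small [s], and every length survives for exactly m + 1 values of [s]. *)
Definition window (s : nat) (x : word -> C) : word -> C :=
  fun w => if (size w <= s <= size w + m)%N then x w else 0.

Lemma window_bound s x q : sqsum (window s x) q <= hnorm x ^+ 2.
Proof.
apply: le_trans (sqsum_le x q); apply: ler_sum => w _; rewrite /window.
by case: ifP => // _; rewrite Normc.normc0 expr0n sqr_ge0.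
Qed.

Definition windowp s x : F2 := Fock (in_fock_bound (window_bound s x)).

Lemma windowpE s x w : windowp s x w = if (size w <= s <= size w + m)%N then x w else 0.
Proof. by []. Qed.

Lemma inner_windowp s x y : inner (windowp s x) y = inner x (windowp s y).
Proof.
apply: inner_unique.
rewrite (_ : (fun q => _) = (fun q => \sum_(w <- words n q) x w * (windowp s y w)^*)).
  exact: cvg_inner.
apply/funext => q; apply: eq_bigr => w _; rewrite !windowpE.
by case: ifP; rewrite // cJ0 mulr0 mul0r.
Qed.

Lemma bounded_windowp s : bounded_op (windowp s).
Proof.
split=> [a x y|].
  apply: fockE => w; rewrite fvalD fvalZ !windowpE; case: ifP => // _.
  by rewrite mulr0 addr0.
exists 1 => x; rewrite mul1r -ler_sqr ?nnegrE ?hnorm_ge0//.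
exact/hnorm_bound/window_bound.
Qed.

(** Each word lies in at most m + 1 windows. *)
Lemma sum_sqr_windowp K q x : (forall w, (q < size w)%N -> x w = 0) ->
  \sum_(s < K) hnorm (windowp s x) ^+ 2 <= m.+1%:R * hnorm x ^+ 2.
Proof.
move=> x0; rewrite (sqr_hnorm_fin x0).
have H s : hnorm (windowp s x) ^+ 2 = sqsum (windowp s x) q.
  by apply: sqr_hnorm_fin => w /x0 wx; rewrite windowpE wx; case: ifP.
under eq_bigr => s _ do rewrite H.
rewrite exchange_big mulr_sumr; apply: ler_sum => w _.
rewrite (_ : \sum_(s < K) _ = (\sum_(s < K) (size w <= s <= size w + m))%:R * nc (x w) ^+ 2).
  by rewrite ler_wpM2r ?sqr_ge0// ler_nat count_window; lia.
rewrite natr_sum mulr_suml; apply: eq_bigr => s _; rewrite windowpE.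
by case: ifP => _; rewrite ?mul1r// mul0r Normc.normc0 expr0n.
Qed.

(* Lengths l and l + d lie together in exactly m + 1 - d of the windows of
   m + 1 consecutive lengths, which produces the Cesaro weights. *)
Lemma cesaro_windows p x : cesaro (trunc p x) =
  (m.+1%:R^-1)%:C *: \sum_(s < p + m.+1) windowp s (T (windowp s (trunc p x))).
Proof.
pose U : op := (m.+1%:R^-1)%:C *:
  \sum_(s < p + m.+1) (windowp s \o T \o windowp s).
have bU : bounded_op U.
  apply: bounded_opZ; apply: bounded_op_sum => s _; apply: bounded_comp (bounded_windowp s).
  exact: bounded_comp (bounded_windowp s) cT.1.
have bX := (Finfty_rcommutant Finfty_cesaro).1.
apply: (@eq_trans _ _ (U (trunc p x))); last by rewrite /U op_scaleE op_sumE.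
rewrite /trunc (op_sum bX.1) (op_sum bU.1) big_seq [RHS]big_seq.
apply: eq_bigr => v; rewrite mem_words => vp; rewrite (opZ bX.1) (opZ bU.1).
congr (_ *: _); apply: fockE => w; rewrite cesaro_evec.
rewrite /U op_scaleE op_sumE fvalZ fval_sum.
rewrite rmorphM mulrAC mulrC; congr (_ * _).
have we s : windowp s (evec R v) =
    (if (size v <= s <= size v + m)%N then 1 else 0 : C) *: evec R v.
  apply: fockE => u; rewrite windowpE fvalZ.
  have [->|uv] := eqVneq u v; first by case: ifP; rewrite ?mul1r ?mul0r.
  by rewrite evec_neq// mulr0; case: ifP.
have step (s : nat) : ((windowp s \o T) \o windowp s) (evec R v) w =
    if (size w <= s <= size w + m)%N then
      (if (size v <= s <= size v + m)%N then 1 else 0) * T (evec R v) w else 0.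
  rewrite -[LHS]/(windowp s (T (windowp s (evec R v))) w) we (opZ cT.1.1).
  by rewrite windowpE fvalZ.
under eq_bigr => s _ do rewrite step.
rewrite (rcommutant_evec _ cT).
have [[u ->]|wv] := suffix_dec v w; last first.
  rewrite rcreations_eq0// mulr0 big1// => s _.
  by rewrite mulr0; case: ifP.
rewrite size_cat addnK.
rewrite (_ : (m.+1 - size u)%N =
   (\sum_(s < p + m.+1) (size u + size v <= s <= size v + m))%N); last first.
  by rewrite count_window; lia.
rewrite natr_sum rmorph_sum mulr_suml; apply: eq_bigr => s _ /=.
case: (boolP (size u + size v <= s <= size v + m)%N) => h.
  have -> : (size u + size v <= s <= size u + size v + m)%N by lia.
  by have -> : (size v <= s <= size v + m)%N by lia.
case: ifP => h1; last by rewrite mul0r.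
have -> : (size v <= s <= size v + m)%N = false.
  by case/andP: h1 h => -> _ /=; rewrite andbC => /negPf ->.
by rewrite !mul0r.
Qed.

(** The image is paired with its own truncation. Each window contributes at most M |P x| |P y|, and
    2ab <= a^2 + b^2 together with the multiplicity count of [sum_sqr_windowp] recovers the constant
    [M]. *)
Lemma hnorm_cesaro (M : R) x : 0 < M -> (forall x, hnorm (T x) <= M * hnorm x) ->
  hnorm (cesaro x) <= M * hnorm x.
Proof.
move=> M0 TM; have bX := (Finfty_rcommutant Finfty_cesaro).1.
apply: hnorm_density bX (ltW M0) _ => p.
rewrite -ler_sqr ?nnegrE ?mulr_ge0 ?hnorm_ge0 ?(ltW M0)//; apply: hnorm_bound => q.
set z := cesaro _; pose y := trunc q z.
have zy : complex.Re (inner z y) = sqsum z q by rewrite innerC trunc_inner cJ_real.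
have N0 : 0 < m.+1%:R :> R by rewrite ltr0n.
(* The last term on the right is half of the left side and gets absorbed. *)
suff H : m.+1%:R * sqsum z q <=
   m.+1%:R * (M ^+ 2 * hnorm (trunc p x) ^+ 2) / 2 + m.+1%:R * sqsum z q / 2.
  by rewrite exprMn; have := ler_pM2l N0 (sqsum z q) (M ^+ 2 * hnorm (trunc p x) ^+ 2); nra.
rewrite -{1}zy {1}/z cesaro_windows innerZl Re_mulC mulrA divff ?gt_eqF// mul1r.
rewrite inner_suml Re_sum -sqr_hnorm_trunc -/y.
have xs : forall w, (p < size w)%N -> trunc p x w = 0.
  by move=> w; rewrite truncE ltnNge => /negPf ->.
have ys : forall w, (q < size w)%N -> y w = 0.
  by move=> w; rewrite truncE ltnNge => /negPf ->.
have Hx := sum_sqr_windowp (p + m.+1) xs; have Hy := sum_sqr_windowp (p + m.+1) ys.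
apply: (@le_trans _ _ (\sum_(s < p + m.+1) (M ^+ 2 * hnorm (windowp s (trunc p x)) ^+ 2 / 2
    + hnorm (windowp s y) ^+ 2 / 2))).
  apply: ler_sum => s _; rewrite inner_windowp; apply: le_trans (Re_inner_le _ _) _.
  have := TM (windowp s (trunc p x)); have := hnorm_ge0 (windowp s y).
  have := sqr_ge0 (M * hnorm (windowp s (trunc p x)) - hnorm (windowp s y)).
  nra.
rewrite big_split /= -!mulr_suml -mulr_sumr; nra.
Qed.

End Means.
End Cesaro.

(** * The commutant is contained in the algebra *)

Section CommutantAlgebra.
Variables (R : realType) (n : nat).
Local Notation C := R[i].
Local Notation nc := (@Normc.normc R).
Local Notation word := (seq 'I_n).
Local Notation F2 := (fock R n).
Local Notation op := (F2 -> F2).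
Implicit Types (x y z h : F2) (v w : word) (a : C) (T U : op) (i j : 'I_n).

Lemma hnorm_evec v : hnorm (evec R v) = 1.
Proof.
apply/eqP; rewrite -(@eqrXn2 _ 2)// ?hnorm_ge0// expr1n.
by apply/eqP/(@complexI R); rewrite -inner_self inner_evec evec_eq.
Qed.

(** The weight falls short of 1 by at most size w / (m + 1), and no matrix entry of [T] exceeds its
    norm bound. *)
Lemma cesaro_coef T m (M : R) v w : rcommutant T -> 0 < M ->
  (forall x, hnorm (T x) <= M * hnorm x) ->
  nc ((T - cesaro T m) (evec R v) w) <= (size w)%:R * M / m.+1%:R.
Proof.
move=> cT M0 TM.
rewrite -[(T - _) _ _]/(T (evec R v) w - cesaro T m (evec R v) w) cesaro_evec//.
set k := (size w - size v)%N; set t := T _ w.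
have N0 : 0 < m.+1%:R :> R by rewrite ltr0n.
have -> : t - ((m.+1 - k)%:R / m.+1%:R)%:C * t = ((m.+1 - (m.+1 - k))%:R / m.+1%:R)%:C * t.
  rewrite [in RHS]natrB ?leq_subr// mulrBl divff ?gt_eqF// rmorphB/= rmorph1.
  by rewrite mulrBl mul1r.
rewrite Normc.normcM nc_real ger0_norm ?divr_ge0//.
have tM : nc t <= M.
  by apply: le_trans (nc_fval_le _ _) _; have := TM (evec R v); rewrite hnorm_evec mulr1.
rewrite mulrAC ler_wpM2r ?invr_ge0//.
apply: ler_pM => //; first exact: nc_ge0.
by rewrite ler_nat /k; lia.
Qed.

(** The uniform bound 2 M on [T - cesaro T m] reduces the pairing to polynomials, where finitely
    many entries decay like 1 / m. *)
Lemma cvg_cesaro T x y (e : R) : rcommutant T -> 0 < e ->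
  exists N, forall m, (N <= m)%N -> nc (inner ((T - cesaro T m) x) y) < e.
Proof.
move=> cT e0; have [M M0 TM] := bounded_pos cT.1.
(* With tolerance e / (8 L), the two truncation errors, multiplied by the norm bound 2 M, add up to
   less than e / 2; the summand 1 keeps [L] positive. *)
pose L := M * (1 + hnorm x + hnorm y).
have L0 : 0 < L by rewrite mulr_gt0// -addrA ltr_pwDl// addr_ge0 ?hnorm_ge0.
have e1 : 0 < e / (8 * L) by rewrite divr_gt0// mulr_gt0.
have [p1 Hp1] := trunc_approx x e1; have [p2 Hp2] := trunc_approx y e1.
pose p := (p1 + p2)%N; pose xp := trunc p x; pose yp := trunc p y.
have xxp : hnorm (x - xp) < e / (8 * L) by apply: Hp1; exact: leq_addr.
have yyp : hnorm (y - yp) < e / (8 * L) by apply: Hp2; exact: leq_addl.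
pose K := (\sum_(v <- words n p) \sum_(w <- words n p) nc (x v) * nc (y w)) * (p%:R * M).
exists (Num.trunc (2 * K / e)) => m mN; pose D := T - cesaro T m.
have bD : bounded_op D.
  apply: bounded_opB; first exact: cT.1.
  exact: (Finfty_rcommutant (@Finfty_cesaro _ _ T m)).1.
have DM z : hnorm (D z) <= 2 * M * hnorm z.
  rewrite -[D z]/(T z - cesaro T m z); apply: le_trans (hnormD _ _) _; rewrite hnormN.
  have := TM z; have := hnorm_cesaro m cT z M0 TM; lra.
have -> : inner (D x) y = inner (D (x - xp)) y + inner (D xp) (y - yp) + inner (D xp) yp.
  by rewrite (opB bD.1) innerBl innerBr; ring.
have N0 : 0 < m.+1%:R :> R by rewrite ltr0n.
have T3 : nc (inner (D xp) yp) <= K / m.+1%:R.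
  rewrite /xp /trunc (op_sum bD.1) inner_suml.
  apply: le_trans (nc_sum _ _ _) _; rewrite /K -mulrA mulr_suml; apply: ler_sum => v _.
  rewrite (opZ bD.1) innerZl Normc.normcM /yp /trunc inner_sumr.
  rewrite -mulr_sumr -mulrA ler_wpM2l ?nc_ge0//.
  apply: le_trans (nc_sum _ _ _) _; rewrite mulr_suml big_seq [leRHS]big_seq.
  apply: ler_sum => w; rewrite mem_words => wp.
  rewrite innerZr Normc.normcM ncJ inner_evec ler_wpM2l ?nc_ge0//.
  apply: le_trans (cesaro_coef _ _ _ cT M0 TM) _.
  by rewrite ler_wpM2r ?invr_ge0// ler_wpM2r ?(ltW M0)// ler_nat.
have K3 : K / m.+1%:R < e / 2.
  rewrite ltr_pdivrMr// -ltr_pdivrMl ?divr_gt0//.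
  rewrite (_ : (e / 2)^-1 * K = 2 * K / e); last by rewrite invf_div mulrAC.
  by rewrite -truncn_le_nat.
have xs : hnorm xp <= hnorm x by exact: hnorm_trunc_le.
have T1 : nc (inner (D (x - xp)) y) <= 2 * M * (e / (8 * L)) * hnorm y.
  apply: le_trans (CauchySchwarz _ _) _; rewrite ler_wpM2r ?hnorm_ge0//.
  by apply: le_trans (DM _) _; rewrite ler_pM2l ?mulr_gt0// ltW.
have T2 : nc (inner (D xp) (y - yp)) <= 2 * M * hnorm x * (e / (8 * L)).
  apply: le_trans (CauchySchwarz _ _) _; apply: ler_pM; rewrite ?hnorm_ge0 ?(ltW yyp)//.
  by apply: le_trans (DM _) _; rewrite ler_pM2l ?mulr_gt0.
have T12 : 2 * M * (e / (8 * L)) * hnorm y + 2 * M * hnorm x * (e / (8 * L)) < e / 2.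
  rewrite (_ : _ + _ = (2 * M * (hnorm x + hnorm y)) * e / (8 * L)); last by ring.
  have L8 : 0 < 8 * L by rewrite mulr_gt0.
  rewrite ltr_pdivrMr// /L; have := hnorm_ge0 x; have := hnorm_ge0 y => hx hy.
  have := mulr_gt0 M0 e0; nra.
have H1 := ncD (inner (D (x - xp)) y) (inner (D xp) (y - yp)).
have H2 := ncD (inner (D (x - xp)) y + inner (D xp) (y - yp)) (inner (D xp) yp).
apply: le_lt_trans H2 _; rewrite (splitr e).
exact: le_lt_trans (lerD (le_trans H1 (lerD T1 T2)) T3) (ltrD T12 K3).
Qed.

(** Every algebra in the definition of [Finfty] contains the Cesaro means, so its weak closedness
    yields [T]. A basic neighbourhood involves finitely many pairs, whose thresholds are added. *)
Lemma rcommutant_Finfty T : rcommutant T -> Finfty T.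
Proof.
move=> cT A Aalg Awot A1 AS; apply: (Awot T cT.1) => s e e0.
suff [N HN] : exists N, forall m, (N <= m)%N ->
    forall p, p \in s -> nc (inner ((T - cesaro T m) p.1) p.2) < e.
  exists (cesaro T N); first exact: (@Finfty_cesaro _ _ T N A Aalg Awot A1 AS).
  by move=> p ps; rewrite normCE ltcR; exact: (HN N (leqnn N) p ps).
elim: s => [|q s [N HN]]; first by exists 0%N.
have [N' HN'] := cvg_cesaro q.1 q.2 cT e0.
exists (N + N')%N => m mN p; rewrite inE => /predU1P[->|].
  exact: HN' (leq_trans (leq_addl _ _) mN).
exact: HN (leq_trans (leq_addr _ _) mN) p.
Qed.

End CommutantAlgebra.

(** * A Lax-Milgram lemma *)

Section LaxMilgram.
Variables (R : realType) (n : nat).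
Local Notation C := R[i].
Local Notation nc := (@Normc.normc R).
Local Notation Re := (@complex.Re R).
Local Notation Im := (@complex.Im R).
Local Notation F2 := (fock R n).
Local Notation op := (F2 -> F2).
Implicit Types (x y z h q : F2) (a : C) (T U : op).

Lemma cvg_real_geometric (u : nat -> R) (K r : R) : 0 <= r < 1 ->
  (forall m, `|u m| <= K * r ^+ m) -> cvgn (series u).
Proof.
move=> /andP[r0 r1] uK; apply: normed_cvg.
apply: (@series_le_cvg _ _ (geometric K r)) => [m|m|m|] //=; last first.
  by apply: is_cvg_geometric_series; rewrite ger0_norm.
by rewrite /geometric /=; exact: le_trans (normr_ge0 _) (uK m).
Qed.

Lemma sum_geometric (r : R) m : (1 - r) * \sum_(i < m) r ^+ i = 1 - r ^+ m.
Proof.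
elim: m => [|m IH]; first by rewrite big_ord0 mulr0 expr0 subrr.
by rewrite big_ord_recr /= mulrDr IH exprS; ring.
Qed.

Lemma cvg_complex_geometric (u : nat -> C) (K r : R) : 0 <= r < 1 -> 0 <= K ->
  (forall m, nc (u m) <= K * r ^+ m) ->
  exists2 l : C^o, (fun m => \sum_(i < m) u i : C^o) @ \oo --> l & nc l <= K / (1 - r).
Proof.
move=> r01 K0 uK; pose s m : C^o := \sum_(i < m) u i.
have [l sl] : exists l : C^o, s @ \oo --> l.
  have /cvg_ex[a ra] : cvgn (series (Re \o u)).
    by apply: (cvg_real_geometric r01) => m; apply: le_trans (Re_le_nc _) (uK m).
  have /cvg_ex[b ib] : cvgn (series (Im \o u)).
    by apply: (cvg_real_geometric r01) => m; apply: le_trans (Im_le_nc _) (uK m).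
  exists (a +i* b); apply: cvg_complex.
    rewrite (_ : _ \o _ = series (Re \o u))//.
    by apply/funext => m; rewrite /= /s Re_sum /series /= big_mkord.
  rewrite (_ : _ \o _ = series (Im \o u))//.
  by apply/funext => m; rewrite /= /s Im_sum /series /= big_mkord.
exists l => //; have [c c1 <-] := nc_le_Re l.
have cl : (fun m => c * s m : C^o) @ \oo --> (c * l : C^o) by exact: (@cvgMr C).
apply: (limn_le_near (cvg_Re cl)); apply: nearW => m /=.
apply: le_trans (ler_norm _) _; apply: le_trans (Re_le_nc _) _.
rewrite Normc.normcM; apply: (@le_trans _ _ (nc (s m))).
  by rewrite ler_piMl ?nc_ge0.
apply: le_trans (nc_sum _ _ _) _.
apply: (@le_trans _ _ (\sum_(i < m) K * r ^+ i)); first by apply: ler_sum => i _.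
case/andP: r01 => r0 r1; have r1' : 0 < 1 - r by rewrite subr_gt0.
rewrite -mulr_sumr ler_wpM2l// -[leRHS]mul1r ler_pdivlMr// mulrC sum_geometric.
by rewrite lerBlDr lerDl exprn_ge0.
Qed.

Lemma cvg_complex0 (u : nat -> C^o) (v : nat -> R) :
  (forall m, nc (u m) <= v m) -> v @ \oo --> 0 -> u @ \oo --> (0 : C^o).
Proof.
move=> uv v0; apply/cvgrPdist_lt => e /gt0_complex[d d0 ->].
have /cvgrPdist_lt/(_ _ d0) vd := v0.
near=> m; rewrite normCE ltcR sub0r ncN; apply: le_lt_trans (uv m) _.
apply: le_lt_trans (ler_norm _) _; rewrite -normrN -sub0r.
by near: m; exact: vd.
Unshelve. all: by end_near. Qed.

(* Richardson iteration t_(m+1) = t_m + th (q - G t_m): the residuals contract,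
   so t_m converges weakly. *)
Lemma lax_milgram (G : op) (c : R) : bounded_op G -> 0 < c ->
  (forall x, c * hnorm x ^+ 2 <= Re (inner (G x) x)) ->
  forall q, exists t, G t = q.
Proof.
move=> bG c0 Gc q; have [M M0 GM] := bounded_pos bG.
(* Enlarging the norm bound by [c] ensures c < B, so that [r2] is nonnegative. *)
pose B := M + c; have B0 : 0 < B by rewrite addr_gt0.
have GB x : hnorm (G x) <= B * hnorm x.
  by apply: le_trans (GM x) _; rewrite ler_wpM2r ?hnorm_ge0// lerDl ltW.
(* This step size minimizes 1 - 2 c th + B^2 th^2, and the minimum is [r2]. *)
pose th := c / B ^+ 2; have th0 : 0 < th by rewrite divr_gt0// exprn_gt0.
pose N x := x - th%:C *: G x.
pose r2 := 1 - c ^+ 2 / B ^+ 2; pose r := Num.sqrt r2.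
have r2_0 : 0 <= r2.
  rewrite subr_ge0 ler_pdivrMr ?exprn_gt0// mul1r ler_sqr ?nnegrE ?ltW//.
  by rewrite ltrDr.
have r01 : 0 <= r < 1.
  rewrite sqrtr_ge0 /= -sqrtr1 ltr_sqrt// /r2 gtrBl.
  by rewrite divr_gt0 ?exprn_gt0.
have Nr x : hnorm (N x) <= r * hnorm x.
  rewrite -ler_sqr ?nnegrE ?mulr_ge0 ?sqrtr_ge0 ?hnorm_ge0// exprMn (sqr_sqrtr r2_0).
  rewrite /N (sqr_hnormD x (- (th%:C *: G x))) hnormN innerNr innerZr.
  rewrite cJ_real ReN Re_mulC sqr_hnormZ nc_real.
  rewrite (innerC (G x) x) ReJ.
  have H2 := Gc x; rewrite (real_normK (num_real th)).
  have H1 : hnorm (G x) ^+ 2 <= B ^+ 2 * hnorm x ^+ 2.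
    by rewrite -exprMn ler_sqr ?nnegrE ?mulr_ge0 ?hnorm_ge0 ?(ltW B0).
  have E : th * B ^+ 2 = c by rewrite /th divfK// gt_eqF// exprn_gt0.
  have E2 : c ^+ 2 / B ^+ 2 = th * c by rewrite /th; ring.
  rewrite /r2 E2; have := ler_wpM2l (sqr_ge0 th) H1; have := ler_wpM2l (ltW th0) H2.
  have -> : th ^+ 2 * (B ^+ 2 * hnorm x ^+ 2) = th * c * hnorm x ^+ 2.
    by rewrite mulrA expr2 -(mulrA th) E.
  lra.
pose res m := iter m N q.
have resr m : hnorm (res m) <= r ^+ m * hnorm q.
  elim: m => [|m IH]; first by rewrite mul1r.
  apply: le_trans (Nr _) _; rewrite exprS -mulrA ler_wpM2l//.
  by case/andP: r01.
pose t m := \sum_(i < m) th%:C *: res i.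
have Gt m : G (t m) = q - res m.
  elim: m => [|m IH]; first by rewrite /t big_ord0 (op0 bG.1) subrr.
  rewrite /t big_ord_recr (opD bG.1) /= -/(t m) IH (opZ bG.1) /N.
  by rewrite opprB addrAC addrA.
(* Only scalar limits of <y, t_m> are taken; their bound in [y] lets Riesz produce the weak limit as
   a vector. *)
have L y : exists l : C^o, (fun m => inner y (t m) : C^o) @ \oo --> l /\
    nc l <= th * hnorm q / (1 - r) * hnorm y.
  have [|m|l sl lK] := @cvg_complex_geometric (fun m => inner y (th%:C *: res m))
    (th * hnorm q * hnorm y) r r01.
  - exact: mulr_ge0 (mulr_ge0 (ltW th0) (hnorm_ge0 _)) (hnorm_ge0 _).
  - apply: le_trans (CauchySchwarz _ _) _; rewrite hnormZ nc_real gtr0_norm//.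
    have -> : th * hnorm q * hnorm y * r ^+ m = hnorm y * (th * (r ^+ m * hnorm q)) by ring.
    by rewrite ler_wpM2l ?hnorm_ge0// ler_pM2l.
  exists l; split; last by rewrite mulrAC.
  rewrite (_ : (fun m => _) = (fun m => \sum_(i < m) inner y (th%:C *: res i)))//.
  by apply/funext => m; rewrite inner_sumr.
have [F FP] := choice L.
have hC := @norm_hausdorff _ C^o.
have K0 : 0 <= th * hnorm q / (1 - r).
  have r1 : 0 <= 1 - r by case/andP: r01 => _ r1; rewrite subr_ge0 ltW.
  exact: divr_ge0 (mulr_ge0 (ltW th0) (hnorm_ge0 _)) r1.
have [a x y|y|s _ sE] := @riesz R n F _ K0; last first.
(* The equation is tested against [y] after moving [G] to its adjoint, so weak convergence
   suffices. *)
- exists s; apply: inner_ext => y; rewrite -(adjointEr s y bG) -sE.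
  transitivity (inner y q - 0 : C^o); last exact: subr0.
  rewrite -(cvg_lim hC (FP (adjoint G y)).1); apply: (cvg_lim hC).
  have c1 : (fun m : nat => inner y q : C^o) @ \oo --> (inner y q : C^o) by exact: cvg_cst.
  have c2 : (fun m : nat => inner y (res m) : C^o) @ \oo --> (0 : C^o).
    apply: (@cvg_complex0 _ (fun m => hnorm y * hnorm q * r ^+ m)) => [m|].
      apply: le_trans (CauchySchwarz _ _) _; rewrite -mulrA ler_wpM2l ?hnorm_ge0//.
      by rewrite mulrC.
    case/andP: r01 => r0 r1; rewrite -[0](mulr0 (hnorm y * hnorm q)).
    by apply: cvgMr; apply: cvg_expr; rewrite ger0_norm.
  rewrite (_ : (fun m => _) = (fun m => inner y q - inner y (res m))).
    exact: (cvgB c1 c2).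
  by apply/funext => m; rewrite adjointEr// Gt innerBr.
- exact: (FP y).2.
- rewrite -(cvg_lim hC (FP (a *: x + y)).1); apply: (cvg_lim hC).
  rewrite (_ : (fun m => _) = (fun m => a * inner x (t m) + inner y (t m))).
    have cx : (fun m => a * inner x (t m) : C^o) @ \oo --> (a * F x : C^o).
      by apply: (@cvgMr C); exact: (FP x).1.
    exact: (cvgD cx (FP y).1).
  by apply/funext => m; rewrite innerDl innerZl.
Qed.

End LaxMilgram.

(** * The corona theorem *)

Section Corona.
Variables (R : realType) (n : nat).
Local Notation C := R[i].
Local Notation nc := (@Normc.normc R).
Local Notation Re := (@complex.Re R).
Local Notation word := (seq 'I_n).
Local Notation F2 := (fock R n).
Local Notation op := (F2 -> F2).
Local Notation e0 := (evec R ([::] : word)).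
Implicit Types (x y z h q : F2) (a : C) (T U : op) (v w : word).

Lemma bounded_rank1 (z y : F2) : bounded_op (fun x => inner x z *: y).
Proof.
split=> [a x u|]; first by rewrite innerDl innerZl scalerDl scalerA.
exists (hnorm z * hnorm y) => x; rewrite hnormZ mulrAC ler_wpM2r ?hnorm_ge0//.
by rewrite mulrC CauchySchwarz.
Qed.

Lemma adjoint_rannihil T i x : rcommutant T ->
  adjoint T (rannihil i x) = rannihil i (adjoint T x).
Proof.
move=> [bT cT]; apply: inner_ext => y.
by rewrite -inner_rcreation -!adjointE// -inner_rcreation cT.
Qed.

Lemma adjoint_coef T x v : rcommutant T ->
  adjoint T x v = inner (rannihils v x) (T e0).
Proof.
move=> cT; rewrite -inner_evec (adjointEr _ _ cT.1) (rcommutant_evec _ cT).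
by rewrite innerC inner_rcreations -innerC.
Qed.

(** [T] never shortens words, so its adjoint never lengthens them; this keeps the sums of the corona
    argument finite. *)
Lemma adjoint_supp T x m : rcommutant T -> (forall w, (m <= size w)%N -> x w = 0) ->
  forall w, (m <= size w)%N -> adjoint T x w = 0.
Proof.
move=> cT x0 w mw; rewrite adjoint_coef// (_ : rannihils _ _ = 0) ?inner0l//.
by apply: fockE => u; rewrite rannihilsE x0// size_cat (leq_trans mw)// leq_addl.
Qed.

Variables (k : nat) (X : 'I_k -> op) (e : R).
Hypotheses (e_gt0 : 0 < e) (cX : forall j, rcommutant (X j))
  (X_ge : forall x, 2 * e * hnorm x ^+ 2 <= \sum_j hnorm (adjoint (X j) x) ^+ 2).

Let bX j : bounded_op (X j) := (cX j).1.
Let bX' j : bounded_op (adjoint (X j)) := bounded_adjoint (bX j).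

(* Subtracting only e from an operator bounded below by 2 e keeps the defect
   strictly positive, so that [gram] below is invertible. *)
Definition defect : op := \sum_j (X j \o adjoint (X j)) - e%:C *: @idop R n.
Local Notation A := defect.

Lemma bounded_defect : bounded_op A.
Proof.
apply: bounded_opB; last exact: bounded_opZ (bounded_idop R n).
by apply: bounded_op_sum => j _; exact: bounded_comp.
Qed.

Lemma defectE x : A x = \sum_j X j (adjoint (X j) x) - e%:C *: x.
Proof. by rewrite -[LHS]/((\sum_j (X j \o adjoint (X j))) x - e%:C *: x) op_sumE. Qed.

Lemma inner_defect x y :
  inner (A x) y = \sum_j inner (adjoint (X j) x) (adjoint (X j) y) - e%:C * inner x y.
Proof.
rewrite defectE innerBl innerZl inner_suml; congr (_ - _).
by apply: eq_bigr => j _; rewrite adjointE.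
Qed.

Lemma inner_defectC x y : inner (A y) x = (inner (A x) y)^*.
Proof.
rewrite !inner_defect cJD cJN cJM cJ_real -innerC cJ_sum; congr (_ - _).
by apply: eq_bigr => j _; rewrite -innerC.
Qed.

(** Storage function of the system below; it stands for the squared norm of A^(1/2) x. *)
Definition energy x : R := Re (inner (A x) x).

Lemma energy_ge x : e * hnorm x ^+ 2 <= energy x.
Proof.
rewrite /energy inner_defect ReD ReN Re_mulC inner_self Re_sum.
under eq_bigr => j _ do rewrite inner_self.
by have := X_ge x; rewrite /=; lra.
Qed.

Lemma energy_ge0 x : 0 <= energy x.
Proof. by apply: le_trans (energy_ge x); rewrite mulr_ge0 ?sqr_ge0// ltW. Qed.

(** Positivity of the form at [x - y]; this plays the part of Cauchy-Schwarz for <A x, y>. *)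
Lemma Re_defect_le x y : 2 * Re (inner (A x) y) <= energy x + energy y.
Proof.
have := energy_ge0 (x - y); rewrite /energy (opB bounded_defect.1).
rewrite innerBl !innerBr !ReD !ReN ReD ReN (inner_defectC x y) ReJ; lra.
Qed.

(** The rank-one term charges the output [x [::]] in the energy balance, which later bounds the
    output. *)
Definition gram : op := fun x => A x + e%:C *: (x [::] *: e0).
Local Notation G := gram.

Lemma bounded_gram : bounded_op G.
Proof.
rewrite (_ : G = A + e%:C *: (fun x => inner x e0 *: e0)).
  apply: bounded_opD; first exact: bounded_defect.
  exact/bounded_opZ/bounded_rank1.
by apply/funext => x; rewrite -[RHS]/(A x + e%:C *: (inner x e0 *: e0)) inner_evec.
Qed.

Lemma Re_gram x : Re (inner (G x) x) = energy x + e * nc (x [::]) ^+ 2.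
Proof.
by rewrite /gram innerDl ReD innerZl Re_mulC innerZl (innerC x e0) inner_evec mulCJ.
Qed.

(** Each X_j commutes with the R_i, so X_j X_j^* minus the sum of the R_i X_j X_j^* R_i^* is X_j P
    X_j^* with P the vacuum projection; for the scalar part the same difference is e P. *)
Lemma gram_sum x : G x = \sum_i rcreation i (A (rannihil i x)) +
   \sum_j adjoint (X j) x [::] *: X j e0.
Proof.
have -> : \sum_i rcreation i (A (rannihil i x)) =
    \sum_j X j (\sum_i rcreation i (rannihil i (adjoint (X j) x)))
      - e%:C *: \sum_i rcreation i (rannihil i x).
  rewrite scaler_sumr (eq_bigr (fun j => \sum_i X j (rcreation i (rannihil i (adjoint (X j) x))))).
    rewrite exchange_big -sumrB; apply: eq_bigr => i _.
    rewrite defectE (opB (bounded_rcreation R i).1) (opZ (bounded_rcreation R i).1).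
    rewrite (op_sum (bounded_rcreation R i).1); congr (_ - _); apply: eq_bigr => j _.
    by rewrite adjoint_rannihil// (cX j).2.
  by move=> j _; rewrite (op_sum (bX j).1).
rewrite sum_rcreation_rannihil /gram defectE.
rewrite [X in _ = X - _ + _](_ : _ = \sum_j X j (adjoint (X j) x) -
   \sum_j adjoint (X j) x [::] *: X j e0); last first.
  rewrite -sumrB; apply: eq_bigr => j _.
  by rewrite sum_rcreation_rannihil (opB (bX j).1) (opZ (bX j).1).
have E (a b c d : F2) : a - c + d = a - b - (c - d) + b.
  by rewrite opprB [RHS]addrAC subrK addrA [LHS]addrAC.
by rewrite scalerBr; exact: E.
Qed.

Lemma Re_gram_sum x : Re (inner (G x) x) =
  \sum_i energy (rannihil i x) + \sum_j nc (adjoint (X j) x [::]) ^+ 2.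
Proof.
rewrite gram_sum innerDl !inner_suml ReD !Re_sum; congr (_ + _).
  by apply: eq_bigr => i _; rewrite inner_rcreation.
apply: eq_bigr => j _; rewrite innerZl (adjointE _ _ (bX j)).
by rewrite innerC inner_evec mulCJ.
Qed.

Lemma gram_coercive x : e * hnorm x ^+ 2 <= Re (inner (G x) x).
Proof.
rewrite Re_gram; apply: le_trans (energy_ge x) _.
by rewrite lerDl mulr_ge0 ?sqr_ge0// ltW.
Qed.

Lemma gram_inj x y : G x = G y -> x = y.
Proof.
move=> xy; apply/eqP; rewrite -subr_eq0; apply/eqP/hnorm_eq0/eqP.
have := gram_coercive (x - y); rewrite (opB bounded_gram.1) xy subrr inner0l /=.
by rewrite pmulr_rle0// => h; rewrite -sqrf_eq0 eq_le h sqr_ge0.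
Qed.

Lemma gram_surj q : exists t, G t = q.
Proof. exact: (lax_milgram bounded_gram e_gt0 gram_coercive). Qed.

Definition gram_inv q : F2 := projT1 (cid (gram_surj q)).
Local Notation Ginv := gram_inv.

Lemma gram_invK q : G (Ginv q) = q.
Proof. exact: projT2 (cid (gram_surj q)). Qed.

Lemma linear_gram_inv : linear Ginv.
Proof.
move=> a x y; apply: gram_inj.
by rewrite bounded_gram.1 !gram_invK.
Qed.

Lemma gramK x : Ginv (G x) = x.
Proof. by apply: gram_inj; rewrite gram_invK. Qed.

(** Applying the inverse to [gram_sum] reads x = sum_i K_i (R_i^* x) + rank-one terms, with this
    operator as K_i. *)
Definition transfer_step i x : F2 := Ginv (rcreation i (A x)).
Local Notation K := transfer_step.

Lemma linear_transfer_step i : linear (K i).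
Proof.
move=> a x y; rewrite /K.
by rewrite bounded_defect.1 (bounded_rcreation R i).1 linear_gram_inv.
Qed.

Definition state v x : F2 := foldl (fun x i => K i x) x v.

Lemma state_rcons v i x : state (rcons v i) x = K i (state v x).
Proof. by rewrite /state foldl_rcons. Qed.

(** State reached from a unit input in channel [j] after the letters of [v]. *)
Definition impulse j v : F2 := state v (Ginv (X j e0)).

Lemma impulse_rcons j v i : impulse j (rcons v i) = K i (impulse j v).
Proof. exact: state_rcons. Qed.

(** Inverting [gram_sum] repeatedly shortens the words of [x] by one letter each time, so a
    polynomial is exhausted after finitely many steps. Read at the empty word, the result is the
    adjoint form of sum_j X_j M_j = 1. *)
Lemma impulse_expansion m x : (forall w, (m <= size w)%N -> x w = 0) ->
  x = \sum_(v <- words n m) \sum_j adjoint (X j) x v *: impulse j v.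
Proof.
elim: m x => [|m IH] x x0.
  have -> : x = 0 by apply: fockE => w; rewrite x0.
  rewrite big1// => v _; rewrite big1// => j _.
  by rewrite (op0 (bX' j).1) scale0r.
rewrite big_words_rcons -{1}[x]gramK gram_sum (opD linear_gram_inv) addrC.
rewrite !(op_sum linear_gram_inv); congr (_ + _); last first.
  by apply: eq_bigr => j _; rewrite (opZ linear_gram_inv).
rewrite exchange_big; apply: eq_bigr => i _.
have xi : forall w, (m <= size w)%N -> rannihil i x w = 0.
  by move=> w mw; rewrite rannihilE x0// size_rcons ltnS.
rewrite -/(K i (rannihil i x)) {1}(IH _ xi) (op_sum (linear_transfer_step i)).
apply: eq_bigr => v _; rewrite (op_sum (linear_transfer_step i)).
apply: eq_bigr => j _; rewrite (opZ (linear_transfer_step i)) impulse_rcons.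
by rewrite adjoint_rannihil.
Qed.

Section Output.
Variable j : 'I_k.

Let g v : C := impulse j v [::].

Section FiniteInput.
Variables (m : nat) (phi : F2).
Hypothesis phi0 : forall w, (m <= size w)%N -> phi w = 0.

(** State at [w] under the input [phi]; it collects the inputs at the words ending in [w]. *)
Let t w : F2 := \sum_(v <- words n m) phi (v ++ w) *: impulse j v.

Let t0 w : (m <= size w)%N -> t w = 0.
Proof.
move=> mw; rewrite /t big1// => v _; rewrite phi0 ?scale0r// size_cat.
by rewrite (leq_trans mw)// leq_addl.
Qed.

Let t_rec w : G (t w) = phi w *: X j e0 + \sum_i rcreation i (A (t (i :: w))).
Proof.
have -> : t w = phi w *: Ginv (X j e0) + \sum_i K i (t (i :: w)).
  rewrite {1}/t -(big_words_trunc (leqnSn m)) => [|v mv]; last first.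
    by rewrite phi0 ?scale0r// size_cat (leq_trans (ltnW mv))// leq_addr.
  rewrite big_words_rcons; congr (_ + _).
  rewrite exchange_big; apply: eq_bigr => i _.
  rewrite (op_sum (linear_transfer_step i)); apply: eq_bigr => v _.
  by rewrite (opZ (linear_transfer_step i)) impulse_rcons cat_rcons.
rewrite (opD bounded_gram.1) (opZ bounded_gram.1) gram_invK (op_sum bounded_gram.1).
by congr (_ + _); apply: eq_bigr => i _; rewrite gram_invK.
Qed.

(** Substituting [t_rec] in 2 Re <G z, z> and splitting each product by 2 Re <a, b> <= |a|^2 + |b|^2
    produces the terms of [Re_gram_sum] at most once, which cancels one copy of Re <G z, z>. This is
    the dissipation inequality of the system. *)
Let energy_step w : energy (t w) + e * nc (t w [::]) ^+ 2 <=
  nc (phi w) ^+ 2 + \sum_i energy (t (i :: w)).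
Proof.
rewrite -Re_gram; set z := t w.
have : 2 * Re (inner (G z) z) <= nc (phi w) ^+ 2 + \sum_i energy (t (i :: w)) +
    Re (inner (G z) z); last by lra.
rewrite [X in _ <= _ + X]Re_gram_sum {1}/z t_rec -/z innerDl ReD inner_suml Re_sum mulrDr.
have tau : inner (X j e0) z = (adjoint (X j) z [::])^*.
  by rewrite (adjointE _ _ (bX j)) innerC inner_evec.
have H1 : 2 * Re (inner (phi w *: X j e0) z) <=
    nc (phi w) ^+ 2 + nc (adjoint (X j) z [::]) ^+ 2.
  rewrite innerZl tau; set b := adjoint _ _ _.
  have := sqr_ge0 (nc (phi w - b)); rewrite !normc_sqr.
  by case: (phi w) b => p1 p2 [b1 b2] /=; nra.
have H2 : 2 * \sum_i Re (inner (rcreation i (A (t (i :: w)))) z) <=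
    \sum_i energy (t (i :: w)) + \sum_i energy (rannihil i z).
  rewrite mulr_sumr -big_split; apply: ler_sum => i _.
  by rewrite inner_rcreation; exact: Re_defect_le.
have H3 : nc (adjoint (X j) z [::]) ^+ 2 <= \sum_l nc (adjoint (X l) z [::]) ^+ 2.
  by rewrite (bigD1 j)//= lerDl sumr_ge0// => l _; exact: sqr_ge0.
lra.
Qed.

(** Summing [energy_step] telescopes, since every nonempty word occurs once as [i :: w]; only the
    nonnegative energy at the empty word is left over. *)
Lemma output_bound : e * \sum_(w <- words n m) nc (t w [::]) ^+ 2 <= hnorm phi ^+ 2.
Proof.
have E : \sum_(w <- words n m) energy (t w) =
    energy (t [::]) + \sum_(w <- words n m) \sum_i energy (t (i :: w)).
  rewrite -(big_words_cons m (fun w => energy (t w))) (big_words_trunc (leqnSn m))// => w mw.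
  by rewrite t0 ?(ltnW mw)// /energy (op0 bounded_defect.1) inner0l.
have := @ler_sum R _ (words n m) xpredT _ _ (fun w _ => energy_step w).
rewrite !big_split /= E -mulr_sumr.
have -> : \sum_(w <- words n m) nc (phi w) ^+ 2 = hnorm phi ^+ 2.
  by rewrite (@sqr_hnorm_fin _ _ m)// => w mw; rewrite phi0// ltnW.
have := energy_ge0 (t [::]); lra.
Qed.

Lemma output_value w : t w [::] = \sum_(v <- words n m) phi (v ++ w) * g v.
Proof. by rewrite fval_sum. Qed.

End FiniteInput.

(** For the truncated conjugate of [g] as input, the output at the empty word is the square sum S
    itself, so e S^2 <= S. *)
Lemma symbol_bound m : sqsum (fun v => (g v)^*) m <= e^-1.
Proof.
set c := fun v => _; pose phi : F2 := trunc m c.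
have phi0 w : (m.+1 <= size w)%N -> phi w = 0 by rewrite truncE ltnNge => /negPf ->.
have := output_bound phi0; rewrite (sqr_hnorm_trunc m c).
set S := sqsum c m; set f := (X in e * X <= _) => H.
have fE : S ^+ 2 <= f.
  rewrite /f (big_wordsD1 (v := [::]))// output_value.
  rewrite (_ : \sum_(v <- _) _ = S%:C).
    rewrite nc_real real_normK ?num_real// lerDl sumr_ge0// => w _; exact: sqr_ge0.
  rewrite (big_words_trunc (leqnSn m)) => [|w mw]; last by rewrite cats0 phi0// mul0r.
  rewrite /S /sqsum rmorph_sum big_seq [RHS]big_seq; apply: eq_bigr => w.
  rewrite mem_words cats0 truncE => ->; rewrite /c mulrC mulCJ ncJ.
  by [].
have S0 : 0 <= S by exact: sqsum_ge0.
have H2 : e * S ^+ 2 <= S by apply: le_trans H; rewrite ler_pM2l.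
have [->|S1] := eqVneq S 0; first by rewrite invr_ge0 ltW.
have Sp : 0 < S by rewrite lt_neqAle eq_sym S1.
rewrite -[leRHS]mul1r ler_pdivlMr// -(ler_pM2r Sp) mul1r.
by rewrite (_ : S * e * S = e * S ^+ 2)//; ring.
Qed.

Definition symbol : F2 := Fock (in_fock_bound symbol_bound).

Lemma symbolE v : symbol v = (g v)^*. Proof. by []. Qed.

Lemma inner_symbol m y : (forall w, (m < size w)%N -> y w = 0) ->
  inner y symbol = \sum_(v <- words n m) y v * g v.
Proof.
move=> y0; rewrite (@inner_fin _ _ m) => [|w /y0 ->]; last by rewrite mul0r.
by apply: eq_bigr => v _; rewrite symbolE cJK.
Qed.

(** For polynomial [y] the pairing with [symbol] is the output and [output_bound] applies; density
    gives the rest, with the finite set of output words fixed to have a bounded operator [L]. *)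
Lemma symbol_op_bound m y :
  sqsum (fun w => inner (rannihils w y) symbol) m <= e^-1 * hnorm y ^+ 2.
Proof.
pose L : op := \sum_(w <- words n m) fun y => inner (rannihils w y) symbol *: evec R w.
have LE z : L z = trunc m (fun w => inner (rannihils w z) symbol) by rewrite /L op_sumE.
have bL : bounded_op L.
  apply: bounded_op_sum => w _.
  exact: bounded_comp (bounded_rank1 symbol (evec R w)) (bounded_rannihils R w).
rewrite -sqr_hnorm_trunc -LE.
have e1 : 0 <= e^-1 by rewrite invr_ge0 ltW.
rewrite -[e^-1](sqr_sqrtr e1) -exprMn ler_sqr ?nnegrE ?mulr_ge0 ?sqrtr_ge0 ?hnorm_ge0//.
apply: hnorm_density => // p.
rewrite -ler_sqr ?nnegrE ?mulr_ge0 ?sqrtr_ge0 ?hnorm_ge0// exprMn (sqr_sqrtr e1).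
set phi := trunc p y; rewrite LE sqr_hnorm_trunc.
have phi0 w : ((m + p).+1 <= size w)%N -> phi w = 0.
  by move=> mw; rewrite truncE ifN// -ltnNge (leq_trans _ mw)// ltnS leq_addl.
rewrite -ler_pdivrMl ?invr_gt0// invrK; apply: le_trans (output_bound phi0).
rewrite ler_pM2l//.
apply: (@le_trans _ _ (sqsum (fun w => inner (rannihils w phi) symbol) (m + p).+1)).
  by apply: sqsum_mono; rewrite ltnW// ltnS leq_addr.
apply: ler_sum => w _; rewrite output_value (@inner_symbol (m + p).+1).
  by under eq_bigr => v _ do rewrite rannihilsE.
by move=> v mv; rewrite rannihilsE phi0// size_cat (leq_trans (ltnW mv))// leq_addr.
Qed.

(** The estimate concerns the adjoint of the multiplier, so [Y] is built first and its adjoint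
    taken. That adjoint sends each e_w to the right translate of the symbol by [w], whence the
    commutation. *)
Lemma symbol_mult : exists2 M : op, rcommutant M & M e0 = symbol.
Proof.
pose Y : op := fun y => Fock (in_fock_bound (fun m => symbol_op_bound m y)).
have YE y w : Y y w = inner (rannihils w y) symbol by [].
have bY : bounded_op Y.
  split=> [a x y|].
    by apply: fockE => w; rewrite fvalD fvalZ !YE (bounded_rannihils R w).1 innerDl innerZl.
  have e1 : 0 <= e^-1 by rewrite invr_ge0 ltW.
  exists (Num.sqrt e^-1) => y.
  rewrite -ler_sqr ?nnegrE ?mulr_ge0 ?sqrtr_ge0 ?hnorm_ge0// exprMn (sqr_sqrtr e1).
  by apply: hnorm_bound => m; exact: symbol_op_bound.
have Me w : adjoint Y (evec R w) = rcreations w symbol.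
  apply: inner_ext => y; rewrite -adjointE// inner_evec YE.
  by rewrite innerC -inner_rcreations -innerC.
exists (adjoint Y); last by rewrite Me.
have bM := bounded_adjoint bY; split => // i x.
rewrite -[LHS]/((adjoint Y \o rcreation i) x) -[RHS]/((rcreation i \o adjoint Y) x).
congr (_ x); apply: op_ext => [||w].
- exact: bounded_comp bM (bounded_rcreation R i).
- exact: bounded_comp (bounded_rcreation R i) bM.
- by rewrite /comp rcreation_evec !Me rcreations_rcons.
Qed.

End Output.

Lemma corona : exists M : 'I_k -> op, (forall j, Finfty (M j)) /\
  \sum_j (X j \o M j) = @idop R n.
Proof.
have HM j : exists M : op, rcommutant M /\ M e0 = symbol j.
  by have [M cM Me] := symbol_mult j; exists M.
have [M MP] := choice HM; exists M; split; first by move=> j; exact: rcommutant_Finfty (MP j).1.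
apply: rcommutant_ext.
- elim/big_ind: _ => [|T U cT cU|j _].
  + exact: (Finfty_rcommutant (@Finfty0 R n)).
  + by rewrite -[T]scale1r; exact: rcommutant_lin.
  + exact: rcommutant_comp (cX j) (MP j).1.
- exact: rcommutant_idop.
apply: fockE => w; rewrite op_sumE -[RHS]/(e0 w).
apply: (inv_inj (@cJK R)); rewrite -!inner_evec -!innerC inner_evec.
have w0 u : ((size w).+1 <= size u)%N -> evec R w u = 0.
  by move=> wu; apply: evec_neq; apply: contraTneq wu => ->; rewrite ltnn.
(* Tested against e_w, the left side is the sum over j of <X_j^* e_w, symbol j>; the expansion of
   e_w, read at the empty word, is the same sum. *)
rewrite [in RHS](impulse_expansion w0) fval_sum inner_sumr.
under [RHS]eq_bigr => v _ do rewrite fval_sum.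
rewrite exchange_big; apply: eq_bigr => j _.
rewrite -[(_ \o _) _]/(X j (M j e0)) (MP j).2 -(adjointEr _ _ (bX j)).
rewrite (@inner_symbol j (size w).+1) => [|u wu]; last first.
  by apply: (adjoint_supp (cX j) w0); exact: ltnW.
by [].
Qed.

End Corona.

(** * Compactness in spaces of complex tuples *)

Section ComplexTopology.
Variable R : realType.
Local Notation C := R[i].
Local Notation nc := (@Normc.normc R).
Local Notation Re := (@complex.Re R).
Local Notation Im := (@complex.Im R).

Lemma continuous_Re : continuous (Re : C^o -> R).
Proof. by move=> z; apply: (@cvg_Re R C^o (nbhs z) _ id z). Qed.

Lemma continuous_Im : continuous (Im : C^o -> R).
Proof. by move=> z; apply: (@cvg_Im R C^o (nbhs z) _ id z). Qed.

Lemma compact_box (M : R) : compact [set z : C^o | `|Re z| <= M /\ `|Im z| <= M].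
Proof.
have cI := @segment_compact R (- M) M.
have cII := compact_setX cI cI.
pose g (p : R * R) : C^o := p.1 +i* p.2.
have cg : continuous g.
  by move=> p; apply: cvg_complex; [exact: cvg_fst|exact: cvg_snd].
rewrite (_ : [set z | _] = g @` (`[- M, M]%classic `*` `[- M, M]%classic)).
  by apply: continuous_compact cII; exact: continuous_subspaceT.
apply/seteqP; split => [[a b] /= [aM bM]|_ [[a b] /= [aM bM] <-]].
  by exists (a, b) => //=; split; rewrite /= in_itv /= -ler_norml.
by move: aM bM; rewrite /= !in_itv /= -!ler_norml.
Qed.

Lemma closed_complex1 (z : C) : closed [set z : C^o].
Proof. by apply: accessible_closed_set1; apply: hausdorff_accessible; exact: norm_hausdorff. Qed.

Section Continuous.
Variable T : topologicalType.

Lemma closed_forall (I : Type) (P : I -> set T) :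
  (forall i, closed (P i)) -> closed [set t | forall i, P i t].
Proof.
move=> cP; rewrite (_ : [set t | _] = \bigcap_(i in setT) P i).
  by apply: closed_bigI => i _; exact: cP.
by apply/seteqP; split => [t Pt i _|t Pt i]; exact: Pt.
Qed.

Lemma closed_eqC (g : T -> C^o) (z : C) : continuous g -> closed [set t | g t = z].
Proof.
move=> cg; have := @closed_comp T C^o g [set z : C^o]; apply.
  by move=> t _; exact: cg.
exact: closed_complex1.
Qed.

Lemma closed_ge0C (g : T -> C^o) : continuous g -> closed [set t | 0 <= (g t : C)].
Proof.
move=> cg; rewrite (_ : [set t | _] =
   [set t | 0 <= Re (g t)] `&` [set t | Im (g t) = 0]); last first.
  apply/seteqP; split => t /=; first by rewrite lecE => /andP[/eqP -> ->].
  by case=> r0 i0; rewrite lecE /= i0 eqxx r0.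
apply: closedI.
  have := @closed_comp T R (Re \o g) [set x | 0 <= x]; apply; last exact: closed_ge.
  by move=> t _; apply: continuous_comp; [exact: cg|exact: continuous_Re].
have := @closed_comp T R (Im \o g) [set 0]; apply.
  by move=> t _; apply: continuous_comp; [exact: cg|exact: continuous_Im].
by apply: accessible_closed_set1; apply: hausdorff_accessible; exact: Rhausdorff.
Qed.

Lemma continuous_sumC (I : Type) (s : seq I) (g : I -> T -> C^o) :
  (forall i, continuous (g i)) -> continuous (fun t => \sum_(i <- s) g i t : C^o).
Proof.
move=> cg; elim: s => [|i s IH] t.
  rewrite (_ : (fun t => _) = fun=> 0); first exact: cvg_cst.
  by apply/funext => u; rewrite big_nil.
rewrite (_ : (fun t => _) = fun t => g i t + \sum_(j <- s) g j t).
  exact: (cvgD (cg i t) (IH t)).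
by apply/funext => u; rewrite big_cons.
Qed.

Lemma continuous_scaleC (a : C) (g : T -> C^o) :
  continuous g -> continuous (fun t => a * g t : C^o).
Proof. by move=> cg t; apply: (@cvgMr C); exact: cg. Qed.

Lemma continuous_row k (g : 'I_k -> T -> C^o) : (forall i, continuous (g i)) ->
  continuous (fun t => \row_i g i t : 'rV[C^o]_k).
Proof.
move=> cg t; apply/cvg_ballP => e e0.
have H : \forall u \near t, forall j : 'I_k, ball (g j t) e (g j u).
  by apply: filter_forall => j; have /cvg_ballP := cg j t; apply.
by apply: filterS H => u Hu; split=> // i j; rewrite !mxE; exact: Hu.
Qed.

End Continuous.

Lemma closure_rowP k (A : set 'rV[C^o]_k) (p : 'rV[C^o]_k) :
  closure A p <-> forall e : R, 0 < e ->
    exists2 a, A a & forall i, nc (p 0 i - a 0 i) < e.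
Proof.
split=> [clA e e0|H B].
  have e0' : 0 < e%:C by rewrite ltcR.
  have [a [Aa Ba]] := clA _ (nbhsx_ballx p e%:C e0').
  exists a => // i; have := Ba.2 0 i; rewrite -ball_normE /= normCE ltcR.
  by [].
move=> /nbhs_ballP[e /gt0_complex[r r0 ->] Be].
have [a Aa Ha] := H _ r0; exists a; split=> //; apply: Be; split=> [|i j]; first by rewrite ltcR.
by rewrite (ord1 i) -ball_normE /= normCE ltcR; exact: Ha.
Qed.

Lemma compact_row k (A : set 'rV[C^o]_k) (M : R) : closed A ->
  (forall a, A a -> forall i, nc (a 0 i) <= M) -> compact A.
Proof.
move=> cA AM.
pose B := [set z : C^o | `|Re z| <= M /\ `|Im z| <= M].
have cB := @rV_compact C^o k (fun=> B) (fun=> @compact_box M).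
have AB : A `<=` [set v | forall i, B (v ord0 i)].
  by move=> a Aa i /=; split; apply: le_trans (AM a Aa i); [exact: Re_le_nc|exact: Im_le_nc].
exact: subclosed_compact cA cB AB.
Qed.

End ComplexTopology.

(** * Densities on words of bounded length *)

Section Kernels.
Variables (R : realType) (n m : nat).
Local Notation C := R[i].
Local Notation nc := (@Normc.normc R).
Local Notation Re := (@complex.Re R).
Local Notation Im := (@complex.Im R).
Local Notation word := (seq 'I_n).
Local Notation F2 := (fock R n).
Local Notation op := (F2 -> F2).
Local Notation W := (words n m).
Local Notation e_ := (evec R).
Implicit Types (x y z h : F2) (v w u : word) (a : C) (T U : op) (i j : 'I_n).

Lemma sum_only1 (V : nmodType) (I : finType) (l : I) (G : I -> V) :
  (forall t, t != l -> G t = 0) -> \sum_t G t = G l.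
Proof. by move=> G0; rewrite (bigD1 l)//= big1 ?addr0// => t /G0. Qed.

(** Indexing by all words lets [rcons] act freely; the support condition confines densities to short
    words, and the product topology gives compactness by Tychonoff. *)
Definition kernel_space := prod_topology (fun _ : word * word => C^o).
Implicit Types r s : kernel_space.

Definition supported r := forall u v, ~~ ((size u <= m)%N && (size v <= m)%N) -> r (u, v) = 0.

Definition kform r x y : C := \sum_(u <- W) \sum_(v <- W) x u * r (u, v) * (y v)^*.

Definition psd r := forall x, 0 <= kform r x x.

Definition ktrace T r : C := \sum_(u <- W) \sum_(v <- W) T (e_ v) u * r (v, u).

Definition densities : set kernel_space :=
  [set r | supported r /\ psd r /\ ktrace (@idop R n) r = 1].

Lemma kformDl r x y z : kform r (x + y) z = kform r x z + kform r y z.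
Proof.
rewrite -big_split; apply: eq_bigr => u _; rewrite -big_split; apply: eq_bigr => v _.
by rewrite fvalD !mulrDl.
Qed.

Lemma kformDr r x y z : kform r z (x + y) = kform r z x + kform r z y.
Proof.
rewrite -big_split; apply: eq_bigr => u _; rewrite -big_split; apply: eq_bigr => v _.
by rewrite fvalD cJD mulrDr.
Qed.

Lemma kformZl r a x z : kform r (a *: x) z = a * kform r x z.
Proof.
rewrite mulr_sumr; apply: eq_bigr => u _; rewrite mulr_sumr; apply: eq_bigr => v _.
by rewrite fvalZ !mulrA.
Qed.

Lemma kformZr r a x z : kform r z (a *: x) = a^* * kform r z x.
Proof.
rewrite mulr_sumr; apply: eq_bigr => u _; rewrite mulr_sumr; apply: eq_bigr => v _.
by rewrite fvalZ cJM mulrCA.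
Qed.

Lemma kform_evecl r u y : supported r ->
  kform r (e_ u) y = \sum_(v <- W) r (u, v) * (y v)^*.
Proof.
move=> sr; case: (leqP (size u) m) => um.
  rewrite /kform (big_words_only um) => [|w wu]; last first.
    by rewrite big1// => v _; rewrite evec_neq// !mul0r.
  by apply: eq_bigr => v _; rewrite evec_eq mul1r.
rewrite [RHS]big1 => [|v _]; last by rewrite sr ?mul0r// negb_and -ltnNge um.
rewrite /kform big_seq big1// => w; rewrite mem_words => wm.
rewrite big1// => v _; rewrite evec_neq ?mul0r//.
by apply: contraTneq um => <-; rewrite -leqNgt.
Qed.

Lemma kform_evecr r u y : supported r ->
  kform r y (e_ u) = \sum_(v <- W) y v * r (v, u).
Proof.
move=> sr; apply: eq_bigr => v _; case: (leqP (size u) m) => um.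
  rewrite (big_words_only um) => [|w wu]; last by rewrite evec_neq// cJ0 mulr0.
  by rewrite evec_eq cJ1 mulr1.
rewrite sr ?mulr0; last by rewrite negb_and -!ltnNge um orbT.
rewrite big_seq big1// => w; rewrite mem_words => wm.
by rewrite evec_neq ?cJ0 ?mulr0//; apply: contraTneq um => <-; rewrite -leqNgt.
Qed.

Lemma kform_evec r u v : supported r -> kform r (e_ u) (e_ v) = r (u, v).
Proof.
move=> sr; rewrite kform_evecl//; case: (leqP (size v) m) => vm.
  rewrite (big_words_only vm) => [|w wv]; last by rewrite evec_neq// cJ0 mulr0.
  by rewrite evec_eq cJ1 mulr1.
rewrite sr; last by rewrite negb_and -!ltnNge vm orbT.
rewrite big_seq big1// => w; rewrite mem_words => wm.
by rewrite evec_neq ?cJ0 ?mulr0//; apply: contraTneq vm => <-; rewrite -leqNgt.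
Qed.

Section Psd.
Variable r : kernel_space.
Hypotheses (sr : supported r) (pr : psd r).

Let expand a u v : kform r (e_ u + a *: e_ v) (e_ u + a *: e_ v) =
  r (u, u) + a^* * r (u, v) + a * r (v, u) + a * a^* * r (v, v).
Proof. by rewrite !kformDl !kformDr !kformZl !kformZr !kform_evec//; ring. Qed.

Lemma kdiag_ge0 u : 0 <= r (u, u).
Proof. by rewrite -kform_evec//; exact: pr. Qed.

Lemma kdiagE u : r (u, u) = (Re (r (u, u)))%:C.
Proof.
have := kdiag_ge0 u; rewrite lecE => /andP[/eqP i0 _].
by apply/eqP; rewrite eq_complex /= i0 !eqxx.
Qed.

(** The form is real at e_u + e_v and at e_u + i e_v, which gives the two real equations. *)
Lemma kherm u v : r (v, u) = (r (u, v))^*.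
Proof.
have := pr (e_ u + 1 *: e_ v); have := pr (e_ u + 'i%C *: e_ v).
rewrite !expand (kdiagE u) (kdiagE v) !lecE.
case: (r (u, v)) (r (v, u)) => a b [c d] /= /andP[/eqP H1 _] /andP[/eqP H2 _].
by apply/eqP; rewrite eq_complex /=; apply/andP; split; apply/eqP; lra.
Qed.

Lemma kdiag2 (a : C) u v :
  0 <= Re (r (u, u)) + 2 * Re (a^* * r (u, v)) + nc a ^+ 2 * Re (r (v, v)).
Proof.
have := pr (e_ u + a *: e_ v); rewrite expand (kherm u v) (kdiagE u) (kdiagE v) lecE.
rewrite normc_sqr; case: (r (u, v)) a => c d [a b] /= /andP[_ H].
by move: H; lra.
Qed.

(** Positivity at e_u + a e_v for a = 1, -1, i, -i. With unit trace this bounds all entries, and it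
    shows that a vanishing diagonal forces a vanishing kernel. *)
Lemma koff_le u v :
  `|Re (r (u, v))| <= (Re (r (u, u)) + Re (r (v, v))) / 2 /\
  `|Im (r (u, v))| <= (Re (r (u, u)) + Re (r (v, v))) / 2.
Proof.
have H1 := kdiag2 1 u v; have H2 := kdiag2 (-1) u v.
have H3 := kdiag2 'i%C u v; have H4 := kdiag2 (- 'i%C) u v.
move: H1 H2 H3 H4; rewrite !normc_sqr; case: (r (u, v)) => c d /=.
by move=> H1 H2 H3 H4; split; rewrite ler_norml; apply/andP; split; lra.
Qed.

End Psd.

Lemma ktrace_id r : ktrace (@idop R n) r = \sum_(u <- W) r (u, u).
Proof.
rewrite /ktrace big_seq [RHS]big_seq; apply: eq_bigr => u; rewrite mem_words => um.
rewrite (big_words_only um) => [|w wu]; last by rewrite evec_neq ?mul0r// eq_sym.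
by rewrite evec_eq mul1r.
Qed.

Lemma densities_diag r u : densities r -> Re (r (u, u)) <= 1.
Proof.
case=> sr [pr]; rewrite ktrace_id => tr1; case: (leqP (size u) m) => um.
  rewrite -[1]/(Re 1) -tr1 Re_sum (big_wordsD1 _ um) lerDl sumr_ge0// => w _.
  by have := kdiag_ge0 sr pr w; rewrite lecE => /andP[].
by rewrite sr ?ler01// negb_and -ltnNge um.
Qed.

Lemma continuous_kernel (p : word * word) : continuous (fun r => r p : C^o).
Proof. exact: (@proj_continuous _ (fun _ => C^o) p). Qed.

Lemma continuous_kform x y : continuous (fun r => kform r x y : C^o).
Proof.
apply: continuous_sumC => u; apply: continuous_sumC => v.
rewrite (_ : (fun r => _) = (fun r => x u * (y v)^* * r (u, v))).
  exact: continuous_scaleC _ (@continuous_kernel (u, v)).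
by apply/funext => r; ring.
Qed.

Lemma continuous_ktrace T : continuous (fun r => ktrace T r : C^o).
Proof.
apply: continuous_sumC => u; apply: continuous_sumC => v.
exact: continuous_scaleC _ (@continuous_kernel (v, u)).
Qed.

Lemma closed_densities : closed densities.
Proof.
apply: closedI; last apply: closedI.
- apply: closed_forall => u; apply: closed_forall => v; apply: closed_forall => _.
  exact: closed_eqC _ (@continuous_kernel (u, v)).
- apply: closed_forall => x; exact: closed_ge0C (@continuous_kform x x).
- exact: closed_eqC _ (@continuous_ktrace _).
Qed.

Lemma compact_densities : compact densities.
Proof.
pose B := [set z : C^o | `|Re z| <= 1 /\ `|Im z| <= 1].
have cB := @tychonoff _ (fun _ : word * word => C^o) (fun=> B) (fun=> @compact_box R 1).
have DB : densities `<=` [set r | forall p, B (r p)].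
  move=> r Dr [u v] /=; have [sr [pr _]] := Dr; have [H1 H2] := koff_le sr pr u v.
  have := densities_diag u Dr; have := densities_diag v Dr => Hu Hv.
  by split; [apply: le_trans H1 _|apply: le_trans H2 _]; lra.
exact: subclosed_compact closed_densities cB DB.
Qed.

Definition rank1 (h : word -> C) : kernel_space := fun p => h p.1 * (h p.2)^*.

Lemma kform_rank1 (h : word -> C) x y : kform (rank1 h) x y =
  (\sum_(u <- W) x u * h u) * (\sum_(u <- W) y u * (h u)^*^*)^*.
Proof.
rewrite mulr_suml; apply: eq_bigr => u _; rewrite cJ_sum mulr_sumr.
by apply: eq_bigr => v _; rewrite cJM !cJK /rank1 /=; ring.
Qed.

Lemma kform_rank1_self (h : word -> C) x : kform (rank1 h) x x =
  (nc (\sum_(u <- W) x u * h u) ^+ 2)%:C.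
Proof.
rewrite kform_rank1 -mulCJ; congr (_ * (_)^*).
by apply: eq_bigr => u _; rewrite cJK.
Qed.

Lemma ktrace_rank1 T h : rcommutant T -> (forall w, (m < size w)%N -> h w = 0) ->
  ktrace T (rank1 h) = inner (T h) h.
Proof.
move=> cT h0; have hE : h = trunc m h.
  by apply: fockE => w; rewrite truncE; case: leqP => // /h0.
rewrite {2}hE /trunc (op_sum cT.1.1) inner_suml /ktrace exchange_big.
apply: eq_bigr => v _; rewrite (opZ cT.1.1) innerZl (@inner_fin _ _ m) => [|w /h0 ->].
  by rewrite mulr_sumr; apply: eq_bigr => u _; rewrite /rank1 /=; ring.
by rewrite cJ0 mulr0.
Qed.

Lemma ktraceD T r s : ktrace T (fun p => r p + s p) = ktrace T r + ktrace T s.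
Proof.
rewrite -big_split; apply: eq_bigr => u _; rewrite -big_split; apply: eq_bigr => v _.
by rewrite mulrDr.
Qed.

Lemma ktraceZ T a r : ktrace T (fun p => a * r p) = a * ktrace T r.
Proof.
rewrite mulr_sumr; apply: eq_bigr => u _; rewrite mulr_sumr; apply: eq_bigr => v _.
by rewrite mulrCA.
Qed.

Lemma kformD r s x y : kform (fun p => r p + s p) x y = kform r x y + kform s x y.
Proof.
rewrite -big_split; apply: eq_bigr => u _; rewrite -big_split; apply: eq_bigr => v _.
by rewrite mulrDr mulrDl.
Qed.

Lemma kformZ a r x y : kform (fun p => a * r p) x y = a * kform r x y.
Proof.
rewrite mulr_sumr; apply: eq_bigr => u _; rewrite mulr_sumr; apply: eq_bigr => v _.
by ring.
Qed.

(** The map r |-> sum_i R_i^* r R_i, a partial trace over the last letter. *)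
Definition strip r : kernel_space :=
  fun p => \sum_i r (rcons p.1 i, rcons p.2 i).

Lemma stripE r u v : strip r (u, v) = \sum_i r (rcons u i, rcons v i).
Proof. by []. Qed.

Lemma double_sum_rcons (G : word -> word -> C) :
  (forall u v, ~~ ((size u <= m)%N && (size v <= m)%N) -> G u v = 0) ->
  (forall v, G [::] v = 0) -> (forall u, G u [::] = 0) ->
  \sum_(u <- W) \sum_(v <- W) G u v =
  \sum_(u <- W) \sum_(v <- W) \sum_i \sum_j G (rcons u i) (rcons v j).
Proof.
move=> G0 Gl Gr; rewrite -(big_words_trunc (leqnSn m)) => [|u um]; last first.
  by rewrite big1// => v _; rewrite G0// negb_and -ltnNge um.
rewrite big_words_rcons big1 ?add0r//; apply: eq_bigr => u _.
rewrite [RHS]exchange_big; apply: eq_bigr => i _ /=.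
rewrite -(big_words_trunc (leqnSn m)) => [|v vm]; last first.
  by rewrite G0// negb_and -!ltnNge vm orbT.
by rewrite big_words_rcons Gr add0r.
Qed.

Section Strip.
Variable r : kernel_space.
Hypotheses (sr : supported r) (rl : forall v, r ([::], v) = 0) (rr : forall u, r (u, [::]) = 0).

Lemma supported_strip : supported (strip r).
Proof.
move=> u v uv; rewrite /strip big1// => i _; rewrite sr//.
by apply: contra uv; rewrite !size_rcons => /andP[/ltnW -> /ltnW ->].
Qed.

(** Commutation gives <T e_(vi), e_(uj)> = <T e_v, e_u> if i = j and 0 otherwise, so summing out the
    last letter loses nothing when the row and column at the empty word are zero. *)
Lemma ktrace_strip T : rcommutant T -> ktrace T (strip r) = ktrace T r.
Proof.
move=> cT; rewrite [RHS](double_sum_rcons (G := fun u v => T (e_ v) u * r (v, u))).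
- apply: eq_bigr => u _; apply: eq_bigr => v _; rewrite mulr_sumr.
  apply: eq_bigr => i _; rewrite (bigD1 i)//= -rcreation_evec cT.2 rcreation_rcons eqxx.
  rewrite big1 ?addr0// => j /negPf ji.
  by rewrite -rcreation_evec cT.2 rcreation_rcons eq_sym ji mul0r.
- by move=> u v; rewrite andbC => uv; rewrite sr// mulr0.
- by move=> v; rewrite rr mulr0.
- by move=> u; rewrite rl mulr0.
Qed.

(** The stripped form at [x] is the sum of the forms of [r] at the R_i x. *)
Lemma psd_strip : psd r -> psd (strip r).
Proof.
move=> pr x; rewrite (_ : kform _ x x = \sum_i kform r (rcreation i x) (rcreation i x)).
  by apply: sumr_ge0 => i _; exact: pr.
rewrite /kform; under [RHS]eq_bigr => l _.
  rewrite (double_sum_rcons (G := fun u v => rcreation l x u * r (u, v) * (rcreation l x v)^*)).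
  - over.
  - by move=> u v uv; rewrite sr// mulr0 mul0r.
  - by move=> v; rewrite rcreation_nil !mul0r.
  - by move=> u; rewrite rcreation_nil cJ0 mulr0.
rewrite [RHS]exchange_big; apply: eq_bigr => u _.
rewrite [RHS]exchange_big; apply: eq_bigr => v _.
rewrite stripE mulr_sumr mulr_suml; apply: eq_bigr => l _.
rewrite [RHS](sum_only1 (l := l)) => [|i /negPf il]; last first.
  by rewrite big1// => j _; rewrite rcreation_rcons il !mul0r.
rewrite [RHS](sum_only1 (l := l)) => [|j /negPf jl]; last first.
  by rewrite !rcreation_rcons jl cJ0 mulr0.
by rewrite !rcreation_rcons eqxx.
Qed.

Definition weight s : R := \sum_(u <- W) (size u)%:R * Re (s (u, u)).

(** Every word charged by [r] loses exactly one letter, so the weight drops by the trace. *)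
Lemma weight_strip : weight (strip r) + \sum_(u <- W) Re (r (u, u)) = weight r.
Proof.
have E (G : word -> R) : (forall u, (m < size u)%N -> G u = 0) -> G [::] = 0 ->
    \sum_(u <- W) G u = \sum_(u <- W) \sum_i G (rcons u i).
  move=> G0 Gn; rewrite -(big_words_trunc (leqnSn m))//.
  by rewrite big_words_rcons Gn add0r.
have r0 u : (m < size u)%N -> r (u, u) = 0 by move=> um; rewrite sr// negb_and -ltnNge um.
rewrite /weight [in RHS]E => [|u um|]; last 2 first.
- by rewrite r0// mulr0.
- by rewrite rl mulr0.
rewrite (E (fun u => Re (r (u, u)))) => [|u um|]; last 2 first.
- by rewrite r0.
- by rewrite rl.
rewrite -big_split; apply: eq_bigr => u _; rewrite /strip Re_sum mulr_sumr -big_split.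
by apply: eq_bigr => i _; rewrite size_rcons -addn1 natrD mulrDl mul1r.
Qed.

End Strip.

Lemma continuous_weight : continuous weight.
Proof.
have -> : weight = Re \o (fun r => \sum_(u <- W) (size u)%:R%:C * r (u, u)).
  by apply/funext => r; rewrite /= Re_sum; apply: eq_bigr => u _; rewrite Re_mulC.
have cg : continuous (fun r : kernel_space => \sum_(u <- W) (size u)%:R%:C * r (u, u) : C^o).
  by apply: continuous_sumC => u; exact: continuous_scaleC _ (@continuous_kernel (u, u)).
by move=> r; exact: (continuous_comp (cg r) (@continuous_Re R _)).
Qed.

End Kernels.

(** * Rank-one representatives and the truncated range *)

Section TruncatedRange.
Variables (R : realType) (n m : nat).
Local Notation C := R[i].
Local Notation nc := (@Normc.normc R).
Local Notation Re := (@complex.Re R).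
Local Notation Im := (@complex.Im R).
Local Notation word := (seq 'I_n).
Local Notation F2 := (fock R n).
Local Notation op := (F2 -> F2).
Local Notation W := (words n m).
Local Notation e_ := (evec R).
Local Notation densities := (@densities R n m).
Local Notation kspace := (kernel_space R n).
Implicit Types (x y z h : F2) (v w u : word) (a : C) (T U : op) (i j : 'I_n).
Implicit Types (r s : kspace).

Section Minimizer.
Variables (k : nat) (f : 'I_k -> op).
Hypothesis cf : forall l, rcommutant (f l).
Variable r : kspace.
Hypothesis Dr : densities r.
Hypothesis r_min : forall s, densities s ->
  (forall l, ktrace m (f l) s = ktrace m (f l) r) -> weight m r <= weight m s.

Let sr : supported m r := Dr.1.
Let pr : psd m r := Dr.2.1.
Let c0 : R := Re (r ([::], [::])).
(** Column of [r] at the empty word, scaled so that [rank1 h] has the same row and column there as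
    [r]; when [c0 = 0] that column vanishes by [col0]. *)
Let h u : C := (Num.sqrt c0)^-1%:C * r (u, [::]).

Let c0_ge0 : 0 <= c0.
Proof. by have := kdiag_ge0 sr pr [::]; rewrite lecE => /andP[]. Qed.

Let col0 u : c0 = 0 -> r (u, [::]) = 0.
Proof.
(* With [c0 = 0] and diagonal entries at most 1, this choice gives 0 <= - 2 |r|^2 + |r|^2 for the
   entry in question. *)
move=> c00; have := kdiag2 sr pr (- (r ([::], u))) [::] u.
have r1 := densities_diag u Dr; rewrite -/c0 c00 add0r ncN cJN mulNr ReN.
rewrite [_^* * _]mulrC mulCJ -[Re _%:C]/(nc _ ^+ 2) => H.
have N0 : nc (r ([::], u)) ^+ 2 = 0.
  by apply/eqP; rewrite eq_le sqr_ge0 andbT; have := sqr_ge0 (nc (r ([::], u))); nra.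
have r0 : r ([::], u) = 0 by apply: Normc.eq0_normc; apply/eqP; rewrite -sqrf_eq0 N0.
by rewrite (kherm sr pr [::] u) r0 cJ0.
Qed.

Let h0 w : (m < size w)%N -> h w = 0.
Proof. by move=> wm; rewrite /h sr ?mulr0// negb_and -ltnNge wm. Qed.

Let hh u v : rank1 h (u, v) = (c0^-1)%:C * r (u, [::]) * r ([::], v).
Proof.
rewrite /rank1 /h /= cJM cJ_real (kherm sr pr [::] v) cJK.
rewrite (_ : (c0^-1)%:C = (Num.sqrt c0)^-1%:C * (Num.sqrt c0)^-1%:C :> C); first by ring.
by rewrite -rmorphM /= -invfM -expr2 sqr_sqrtr.
Qed.

(* Schur complement of the entry of r at the pair of empty words. *)
Let sg : kspace := fun p => r p + (-1) * rank1 h p.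

Let sg_supp : supported m sg.
Proof.
move=> u v uv; rewrite /sg hh sr// add0r.
move: uv; rewrite negb_and => /orP[um|vm].
  by rewrite [r (u, _)]sr ?negb_and ?um// mulr0 mul0r mulr0.
by rewrite [r (_, v)]sr ?negb_and ?vm ?orbT// !mulr0.
Qed.

Let r00 : r ([::], [::]) = c0%:C.
Proof. exact: (kdiagE sr pr [::]). Qed.

Let sg_l v : sg ([::], v) = 0.
Proof.
rewrite /sg hh r00; have [c00|cn] := eqVneq c0 0.
  by rewrite (kherm sr pr v [::]) (col0 _ c00) cJ0 mulr0 mulr0 addr0.
by rewrite -rmorphM/= mulVf// mul1r mulN1r subrr.
Qed.

Let sg_r u : sg (u, [::]) = 0.
Proof.
rewrite /sg hh r00; have [c00|cn] := eqVneq c0 0.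
  by rewrite (col0 _ c00) mulr0 mul0r mulr0 addr0.
by rewrite mulrAC -rmorphM/= mulVf// mul1r mulN1r subrr.
Qed.

Let sg_psd : psd m sg.
Proof.
(* Completing the square: [b] minimizes the form of [r] along the direction of the empty word, and
   the minimum is the form of the Schur complement. *)
move=> x; set b : C := (c0^-1)%:C * \sum_(u <- W) x u * r (u, [::]).
rewrite (_ : kform m sg x x = kform m r (x - b *: e_ [::]) (x - b *: e_ [::])); first exact: pr.
set q := \sum_(u <- W) x u * r (u, [::]) in b *.
have q1 : kform m r x (e_ [::]) = q by exact: kform_evecr.
have q2 : kform m r (e_ [::]) x = q^*.
  rewrite kform_evecl// cJ_sum; apply: eq_bigr => v _.
  by rewrite cJM (kherm sr pr v [::]) mulrC.
have -> : kform m sg x x = kform m r x x + (-1) * kform m (rank1 h) x x.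
  by rewrite /sg kformD kformZ.
rewrite (kform_rank1_self m h x) (_ : x - b *: _ = x + (- b) *: e_ [::]); last by rewrite scaleNr.
rewrite !kformDl !kformDr !kformZl !kformZr q1 q2 kform_evec// r00.
have -> : (nc (\sum_(u <- W) x u * h u) ^+ 2)%:C = (c0^-1)%:C * (q * q^*).
  rewrite (_ : \sum_(u <- W) x u * h u = (Num.sqrt c0)^-1%:C * q); last first.
    by rewrite mulr_sumr; apply: eq_bigr => u _; rewrite /h mulrCA.
  rewrite -mulCJ cJM cJ_real mulrACA -rmorphM/= -invfM -expr2 sqr_sqrtr//.
have [c00|cn] := eqVneq c0 0.
  by rewrite /b c00 invr0 !(mul0r, oppr0, rmorph0) !(mul0r, mulr0, addr0, cJ0).
have bE : b * c0%:C = q by rewrite /b mulrAC -rmorphM/= mulVf// mul1r.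
have -> : (c0^-1)%:C * (q * q^*) = b * q^* by rewrite mulrA.
have -> : (- b)^* = - b^* by exact: cJN.
have bE' : b^* * c0%:C = q^* by rewrite -bE cJM cJ_real.
rewrite -bE'; rewrite -bE; ring.
Qed.

(** Competitor of the minimizer: same traces, smaller weight unless the Schur complement
    vanishes. *)
Let tau : kspace := fun p => rank1 h p + strip sg p.

Let tr_sg T : ktrace m T r = ktrace m T (rank1 h) + ktrace m T sg.
Proof. by rewrite /sg ktraceD ktraceZ; ring. Qed.

Let tau_trace T : rcommutant T -> ktrace m T tau = ktrace m T r.
Proof. by move=> cT; rewrite /tau ktraceD ktrace_strip// tr_sg. Qed.

Let tau_densities : densities tau.
Proof.
split; [|split].
- move=> u v uv; rewrite /tau (supported_strip sg_supp uv) addr0 hh.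
  move: uv; rewrite negb_and => /orP[um|vm].
    by rewrite [r (u, _)]sr ?negb_and ?um// mulr0 mul0r.
  by rewrite [r (_, v)]sr ?negb_and ?vm ?orbT// mulr0.
- move=> x; rewrite /tau kformD addr_ge0//; last exact: (psd_strip sg_supp sg_psd x).
  by rewrite kform_rank1_self ler0c sqr_ge0.
- by rewrite tau_trace; [exact: Dr.2.2|exact: rcommutant_idop].
Qed.

(** Minimality against [tau] makes the trace of [sg] nonpositive; positivity then kills its diagonal
    and, by [koff_le], every entry. *)
Let sg0 p : sg p = 0.
Proof.
have H : weight m r <= weight m tau.
  by apply: r_min => // l; exact: tau_trace.
have wD s t : weight m (fun p => s p + t p) = weight m s + weight m t.
  by rewrite -big_split; apply: eq_bigr => u _; rewrite ReD mulrDr.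
have wr : weight m r = weight m (rank1 h) + weight m sg.
  by rewrite -wD; apply: eq_bigr => u _; rewrite /sg mulN1r addrC subrK.
have := weight_strip sg_supp sg_l; rewrite -/(weight m sg) => ws.
have S0 : \sum_(u <- W) Re (sg (u, u)) <= 0.
  have wt : weight m tau = weight m (rank1 h) + weight m (strip sg) by exact: wD.
  by rewrite wr wt in H; lra.
have d0 u : 0 <= Re (sg (u, u)).
  by have := kdiag_ge0 sg_supp sg_psd u; rewrite lecE => /andP[].
have dE u : Re (sg (u, u)) = 0.
  case: (leqP (size u) m) => um; last by rewrite sg_supp// negb_and -ltnNge um.
  apply/eqP; rewrite eq_le d0 andbT; apply: le_trans S0.
  by rewrite (big_wordsD1 _ um) lerDl sumr_ge0.
case: p => u v; have [] := koff_le sg_supp sg_psd u v.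
rewrite !dE addr0 mul0r !normr_le0 => /eqP R0 /eqP I0.
by apply/eqP; rewrite eq_complex /= R0 I0 eqxx.
Qed.

Lemma minimizer_rank1 : exists y : F2, [/\ forall w, (m < size w)%N -> y w = 0,
  hnorm y = 1 & forall l, inner (f l y) y = ktrace m (f l) r].
Proof.
pose y : F2 := trunc m h.
have y0 w : (m < size w)%N -> y w = 0 by move=> wm; rewrite truncE leqNgt wm.
have yh w : y w = h w by rewrite truncE; case: leqP => // /h0.
have tr T : rcommutant T -> inner (T y) y = ktrace m T r.
  move=> cT; rewrite -(ktrace_rank1 cT y0) tr_sg.
  rewrite (_ : ktrace m T sg = 0) ?addr0; last first.
    by rewrite /ktrace big1// => u _; rewrite big1// => v _; rewrite sg0 mulr0.
  by apply: eq_bigr => u _; apply: eq_bigr => v _; rewrite /rank1 /= !yh.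
exists y; split=> //; last by move=> l; exact: tr.
have := tr _ (@rcommutant_idop R n); rewrite Dr.2.2 inner_self => /complexI H.
by apply/eqP; rewrite -(@eqrXn2 _ 2)// ?hnorm_ge0// H expr1n.
Qed.

End Minimizer.

Section Range.
Variables (k : nat) (f : 'I_k -> op).
Hypothesis cf : forall l, rcommutant (f l).

(** The weight is continuous, so it attains its minimum on the compact set of densities sharing the
    traces of [r]. *)
Lemma densities_rank1 r : densities r ->
  exists y : F2, [/\ forall w, (m < size w)%N -> y w = 0,
    hnorm y = 1 & forall l, inner (f l y) y = ktrace m (f l) r].
Proof.
move=> Dr.
pose D := densities `&` [set s : kspace | forall l, ktrace m (f l) s = ktrace m (f l) r].
have cD : compact D.
  apply: compact_closedI; first exact: compact_densities.
  by apply: closed_forall => l; exact: closed_eqC _ (@continuous_ktrace _ _ _ _).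
have [s] := compact_EVT_min (ex_intro D r (conj Dr (fun=> erefl))) cD
  (continuous_subspaceT (@continuous_weight R n m)).
rewrite inE => -[Ds sf] smin.
have [|y [y0 y1 yf]] := minimizer_rank1 cf Ds.
  move=> t Dt tf; apply: smin; rewrite inE; split=> // l /=; rewrite tf; exact: sf.
by exists y; split=> // l; rewrite yf sf.
Qed.

Lemma poly_leP y : poly_le m y <-> forall w, (m < size w)%N -> y w = 0.
Proof.
split=> [[c ->] w mw|y0].
  rewrite -(big_mkord xpredT (fun q : nat => \sum_(w : q.-tuple 'I_n) c w *: e_ w)).
  rewrite -(big_words m (fun w => c w *: e_ w)).
  by rewrite -[\sum_(_ <- _) _]/(trunc m c) truncE leqNgt mw.
exists y; rewrite -(big_mkord xpredT (fun q : nat => \sum_(w : q.-tuple 'I_n) y w *: e_ w)).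
rewrite -(big_words m (fun w => y w *: e_ w)).
by apply: fockE => w; rewrite -[\sum_(_ <- _) _]/(trunc m y) truncE; case: leqP => // /y0.
Qed.

Lemma inner_orthproj x y : poly_le m y -> inner (orthproj (poly_le m) x) y = inner x y.
Proof.
move=> my; suff [_ H] : [set z | poly_le m z /\ forall y, poly_le m y -> inner (x - z) y = 0]
    (orthproj (poly_le m) x).
  by apply/esym/eqP; rewrite -subr_eq0 -innerBl H.
apply: xgetPex; exists (trunc m x); split.
  by apply/poly_leP => w mw; rewrite truncE leqNgt mw.
move=> z /poly_leP z0; apply: inner_unique; rewrite (_ : (fun q => _) = fun=> 0).
  exact: cvg_cst.
apply/funext => q; rewrite big1// => w _; rewrite fvalB truncE.
by case: leqP => [|/z0 ->]; rewrite ?subrr ?mul0r// cJ0 mulr0.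
Qed.

Definition trace_row r : 'rV[C^o]_k := \row_l ktrace m (f l) r.

(** Unit vectors give rank-one densities, and [densities_rank1] goes back. Compactness and convexity
    of the range are inherited from [densities] through this equality. *)
Lemma num_range_densities :
  num_range (poly_le m) (fun l => orthproj (poly_le m) \o f l) = trace_row @` densities.
Proof.
apply/seteqP; split => [_ [y [my y1] <-]|_ [r Dr <-]].
  have y0 := (poly_leP y).1 my.
  exists (rank1 y); last first.
    by apply/rowP => l; rewrite !mxE inner_orthproj// ktrace_rank1.
  split; [|split].
  - move=> u v; rewrite negb_and -!ltnNge => /orP[um|vm]; rewrite /rank1 /=.
      by rewrite y0// mul0r.
    by rewrite (y0 v vm) cJ0 mulr0.
  - by move=> x; rewrite kform_rank1_self ler0c sqr_ge0.
  - by rewrite ktrace_rank1//; [rewrite inner_self y1 expr1n|exact: rcommutant_idop].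
have [y [y0 y1 yf]] := densities_rank1 Dr.
have my : poly_le m y by apply/poly_leP.
by exists y => //; apply/rowP => l; rewrite !mxE inner_orthproj// yf.
Qed.

Lemma num_range_poly :
  num_range (poly_le m) f = num_range (poly_le m) (fun l => orthproj (poly_le m) \o f l).
Proof.
apply/seteqP; split => [_ [y [my y1] <-]|_ [y [my y1] <-]]; exists y => //;
  by apply/rowP => l; rewrite !mxE inner_orthproj.
Qed.

Lemma compact_num_range_trunc :
  compact (num_range (poly_le m) (fun l => orthproj (poly_le m) \o f l)).
Proof.
rewrite num_range_densities; apply: continuous_compact; last exact: compact_densities.
apply: continuous_subspaceT; apply: continuous_row => l; exact: continuous_ktrace.
Qed.

Lemma convex_num_range_trunc :
  convex_set (num_range (poly_le m) (fun l => orthproj (poly_le m) \o f l)).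
Proof.
rewrite num_range_densities => x y t; rewrite !inE => -[r Dr rx] [s Ds sy].
pose a : C := t%:num; pose b : C := 1 - a.
have a0 : 0 <= a by rewrite /a; apply: ge0.
have b0 : 0 <= b by rewrite subr_ge0 /a; apply: le1.
exists (fun p => a * r p + b * s p).
  split; [|split].
  - by move=> u v uv; rewrite (Dr.1 _ _ uv) (Ds.1 _ _ uv) !mulr0 addr0.
  - by move=> z; rewrite kformD !kformZ; apply: addr_ge0; apply: mulr_ge0 => //;
      [exact: Dr.2.1|exact: Ds.2.1].
  - by rewrite ktraceD !ktraceZ Dr.2.2 Ds.2.2 !mulr1 /b addrC subrK.
rewrite -rx -sy -[RHS]/(a *: trace_row r + b *: trace_row s); apply/rowP => l.
by rewrite !mxE ktraceD !ktraceZ.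
Qed.

End Range.
End TruncatedRange.

(** * Numerical range and right spectrum *)

Section JointRange.
Variables (R : realType) (n k : nat).
Local Notation C := R[i].
Local Notation nc := (@Normc.normc R).
Local Notation Re := (@complex.Re R).
Local Notation word := (seq 'I_n).
Local Notation F2 := (fock R n).
Local Notation op := (F2 -> F2).
Local Notation e0 := (evec R ([::] : word)).
Local Notation rows := 'rV[C^o]_k.
Implicit Types (x y z h : F2) (v w u : word) (a : C) (T U : op) (l : rows).
Variable f : 'I_k -> op.
Hypothesis cf : forall i, rcommutant (f i).

Let bf i : bounded_op (f i) := (cf i).1.

Lemma uniform_bound (T : 'I_k -> op) : (forall i, bounded_op (T i)) ->
  exists2 M : R, 0 < M & forall i h, hnorm (T i h) <= M * hnorm h.
Proof.
move=> bT; have H i : exists M : R, 0 < M /\ forall h, hnorm (T i h) <= M * hnorm h.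
  by have [M M0 TM] := bounded_pos (bT i); exists M.
have [N NP] := choice H; exists (1 + \sum_i N i).
  by rewrite ltr_wpDr// sumr_ge0// => i _; rewrite ltW// (NP i).1.
move=> i h; apply: le_trans ((NP i).2 h) _; rewrite ler_wpM2r ?hnorm_ge0//.
rewrite (bigD1 i)//= addrCA lerDl addr_ge0// sumr_ge0// => j _.
by rewrite ltW// (NP j).1.
Qed.

Lemma nc_num_range : exists M : R, forall p, num_range setT f p -> forall i, nc (p 0 i) <= M.
Proof.
have [M M0 fM] := uniform_bound bf; exists M => _ [h [_ h1] <-] i; rewrite mxE.
apply: le_trans (CauchySchwarz _ _) _; rewrite h1 mulr1.
by apply: le_trans (fM i h) _; rewrite h1 mulr1.
Qed.

Lemma compact_closure_num_range : compact (closure (num_range setT f)).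
Proof.
have [M fM] := nc_num_range; apply: (@compact_row _ _ _ M); first exact: closed_closure.
move=> p /closure_rowP cp i; apply/ler_addgt0Pr => e e_gt0.
have [q Aq pq] := cp _ e_gt0; rewrite -[p 0 i](subrK (q 0 i)) [leRHS]addrC.
by apply: le_trans (ncD _ _) _; apply: lerD; [exact: ltW|exact: fM].
Qed.

Lemma num_range_approx p (e : R) : num_range setT f p -> 0 < e ->
  exists N, forall m, (N <= m)%N ->
    exists2 q, num_range (poly_le m) f q & forall i, nc (p 0 i - q 0 i) < e.
Proof.
move=> [h [_ h1] <-] e_gt0; have [M M0 fM] := uniform_bound bf.
have D0 : 0 < 4 * M + 2 * e by rewrite addr_gt0// mulr_gt0.
(* The denominator gives both d < 1, so that the truncation is nonzero, and 4 M d < e, which covers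
   two pairings of size at most M (2 d). *)
pose d := e / (4 * M + 2 * e); have d0 : 0 < d by rewrite divr_gt0.
have d2 : d < 1 by rewrite ltr_pdivrMr// mul1r; lra.
have dM : 4 * M * d < e.
  by rewrite mulrA ltr_pdivrMr//; have := mulr_gt0 e_gt0 e_gt0; nra.
have [N HN] := trunc_approx h d0; exists N => m /HN hd.
pose y := trunc m h; pose s := hnorm y.
have s1 : s <= 1 by rewrite -h1; exact: hnorm_trunc_le.
have sd : 1 - s < d.
  apply: le_lt_trans hd; rewrite lerBlDr -h1 -{1}[h](subrK y); exact: hnormD.
have s0 : 0 < s by lra.
pose g := (s^-1)%:C *: y.
have g1 : hnorm g = 1 by rewrite hnormZ nc_real ger0_norm ?invr_ge0 ?(ltW s0)// mulVf ?gt_eqF.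
have hg : hnorm (h - g) < 2 * d.
  apply: le_lt_trans (hnorm_distD h y g) _; rewrite mulr_natl mulr2n; apply: ltrD => //.
  rewrite (_ : y - g = (1 - s^-1)%:C *: y); last first.
    by rewrite rmorphB/= scalerBl scale1r.
  rewrite hnormZ nc_real -/s -[X in _ * X](gtr0_norm s0) -normrM mulrBl mul1r mulVf ?gt_eqF//.
  by rewrite distrC ger0_norm// subr_ge0.
exists (\row_i inner (f i g) g).
  exists g; split=> //; apply/poly_leP => w mw.
  by rewrite fvalZ truncE leqNgt mw mulr0.
move=> i; rewrite !mxE.
have -> : inner (f i h) h - inner (f i g) g = inner (f i (h - g)) h + inner (f i g) (h - g).
  by rewrite (opB (bf i).1) innerBl innerBr; ring.
apply: le_lt_trans (ncD _ _) _.
have H1 : nc (inner (f i (h - g)) h) <= M * hnorm (h - g).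
  by apply: le_trans (CauchySchwarz _ _) _; rewrite h1 mulr1.
have H2 : nc (inner (f i g) (h - g)) <= M * hnorm (h - g).
  apply: le_trans (CauchySchwarz _ _) _; rewrite ler_wpM2r ?hnorm_ge0//.
  by apply: le_trans (fM i g) _; rewrite g1 mulr1.
have H3 : M * hnorm (h - g) < M * (2 * d) by rewrite ltr_pM2l.
lra.
Qed.

Lemma num_range_polyS m : num_range (poly_le m) f `<=` num_range setT f.
Proof. by move=> _ [h [_ h1] <-]; exists h. Qed.

(** Truncated ranges approximate from some degree on, so two points can be approximated inside the
    same one, where convexity is known. *)
Lemma convex_closure_num_range : convex_set (closure (num_range setT f)).
Proof.
move=> x y t /set_mem cx0 /set_mem cy0; apply/mem_set.
have cx := (closure_rowP (num_range setT f) (x : rows)).1 cx0.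
have cy := (closure_rowP (num_range setT f) (y : rows)).1 cy0.
apply: (closure_rowP (num_range setT f) (conv t x y : rows)).2 => e e_gt0.
have e2 : 0 < e / 2 by rewrite divr_gt0.
have e4 : 0 < e / 4 by rewrite divr_gt0.
have [p Ap xp] := cx _ e4; have [q Aq yq] := cy _ e4.
have [N1 H1] := num_range_approx Ap e4; have [N2 H2] := num_range_approx Aq e4.
have [p' Wp pp] := H1 (N1 + N2)%N (leq_addr _ _).
have [q' Wq qq] := H2 (N1 + N2)%N (leq_addl _ _).
have Wcv : convex_set (num_range (poly_le (N1 + N2)%N) f).
  by rewrite num_range_poly; exact: convex_num_range_trunc.
have Wc := set_mem (Wcv p' q' t (mem_set Wp) (mem_set Wq)).
exists (conv t (p' : convex_lmodType rows) q'); first exact: num_range_polyS Wc.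
pose a : C := t%:num; pose b : C := 1 - a.
have a0 : 0 <= a by rewrite /a; apply: ge0.
have b0 : 0 <= b by rewrite subr_ge0 /a; apply: le1.
have ncE (c : C) : 0 <= c -> nc c = Re c.
  case: c => c1 c2; rewrite lecE /= => /andP[/eqP -> r0].
  by rewrite expr0n addr0 sqrtr_sqr ger0_norm.
have ab : nc a + nc b = 1.
  by rewrite !ncE// -ReD /b addrC subrK.
move=> i; rewrite -[conv t x y]/(a *: (x : rows) + b *: (y : rows)).
rewrite -[conv t (p' : convex_lmodType rows) q']/(a *: p' + b *: q') !mxE.
rewrite (_ : _ - _ = a * (x 0 i - p' 0 i) + b * (y 0 i - q' 0 i)); last by ring.
apply: le_lt_trans (ncD _ _) _; rewrite !Normc.normcM.
have xp' : nc (x 0 i - p' 0 i) <= e / 2.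
  rewrite -[X in nc X](subrKA (p 0 i)); apply: le_trans (ncD _ _) _.
  by have := xp i; have := pp i; lra.
have yq' : nc (y 0 i - q' 0 i) <= e / 2.
  rewrite -[X in nc X](subrKA (q 0 i)); apply: le_trans (ncD _ _) _.
  by have := yq i; have := qq i; lra.
apply: (@le_lt_trans _ _ ((nc a + nc b) * (e / 2))); last by rewrite ab; lra.
by rewrite mulrDl; apply: lerD; rewrite ler_wpM2l ?nc_ge0.
Qed.

(** * Right spectrum and lower bounds *)

Section Spectrum.

Definition shifted l i : op := l 0 i *: @idop R n - f i.

(** The operator inequality of the theorem in terms of adjoint norms, with [c] in the place of
    delta^2. *)
Definition bounded_below l := exists2 c : R, 0 < c &
  forall h, c * hnorm h ^+ 2 <= \sum_i hnorm (adjoint (shifted l i) h) ^+ 2.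

Lemma rcommutant_shifted l i : rcommutant (shifted l i).
Proof.
rewrite /shifted addrC -scaleN1r; apply: rcommutant_lin; first exact: cf.
split; first exact: bounded_opZ (bounded_idop R n).
by move=> j x; rewrite -[RHS]/(rcreation j (l 0 i *: x)) (opZ (bounded_rcreation R j).1).
Qed.

Lemma adjoint_shifted l i h :
  adjoint (shifted l i) h = (l 0 i)^* *: h - adjoint (f i) h.
Proof.
apply: inner_ext => x; rewrite -adjointE; last exact: (rcommutant_shifted l i).1.
rewrite innerBr innerZr cJK -(adjointE _ _ (bf i)).
by rewrite -[shifted l i x]/(l 0 i *: x - f i x) innerBl innerZl.
Qed.

Lemma inner_sum_shifted l h :
  inner ((\sum_i (shifted l i \o ((l 0 i)^* *: @idop R n - adjoint (f i)))) h) h =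
  (\sum_i hnorm (adjoint (shifted l i) h) ^+ 2)%:C.
Proof.
rewrite op_sumE inner_suml rmorph_sum; apply: eq_bigr => i _.
rewrite -[(_ \o _) h]/(shifted l i ((l 0 i)^* *: h - adjoint (f i) h)) -adjoint_shifted.
by rewrite (adjointE _ _ (rcommutant_shifted l i).1) inner_self.
Qed.

Lemma bounded_belowP l : bounded_below l <-> exists2 delta : R, 0 < delta &
  op_le ((delta ^+ 2)%:C *: @idop R n)
    (\sum_i (shifted l i \o ((l 0 i)^* *: @idop R n - adjoint (f i)))).
Proof.
split=> [[c c0 H]|[d d0 H]].
  exists (Num.sqrt c); first by rewrite sqrtr_gt0.
  move=> h; rewrite inner_sum_shifted (sqr_sqrtr (ltW c0)).
  rewrite -[(_ *: _) h]/(c%:C *: h) innerZl inner_self -rmorphM lecR; exact: H.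
exists (d ^+ 2); first by rewrite exprn_gt0.
move=> h; have := H h; rewrite inner_sum_shifted.
by rewrite -[(_ *: _) h]/((d ^+ 2)%:C *: h) innerZl inner_self -rmorphM lecR.
Qed.

(** The sums [\sum_i (X i \o g i)] already form a right ideal, additivity of the [X i] allowing two
    of them to be added, and every right ideal containing the [X i] contains them. *)
Lemma right_ideal_gen_id (X : 'I_k -> op) : (forall i, Finfty (X i)) ->
  right_ideal_gen X (@idop R n) <->
  exists g : 'I_k -> op, (forall i, Finfty (g i)) /\ \sum_i (X i \o g i) = @idop R n.
Proof.
move=> FX; split=> [H|[g [Fg Xg]] J [_ J0 JD JM] JX]; last first.
  rewrite -Xg; elim/big_ind: _ => // i _; exact: JM.
have lX i : linear (X i) := (Finfty_rcommutant (FX i)).1.1.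
suff [g Fg Xg] : [set T | exists2 g : 'I_k -> op, forall i, Finfty (g i) &
    T = \sum_i (X i \o g i)] (@idop R n) by exists g.
apply: H => [|i]; last first.
  exists (fun j => if j == i then @idop R n else 0) => [j|].
    by case: ifP => _; [exact: Finfty_idop|exact: Finfty0].
  apply/funext => x; rewrite op_sumE (bigD1 i)//= eqxx big1 ?addr0// => j /negPf ->.
  exact: op0.
split.
- by move=> _ [g Fg ->]; apply: Finfty_sum => i _; exact: Finfty_comp.
- exists (fun=> 0) => [i|]; first exact: Finfty0.
  by apply/funext => x; rewrite op_sumE big1// => i _; exact: op0.
- move=> _ _ [g Fg ->] [g' Fg' ->]; exists (fun i => g i + g' i) => [i|].
    exact: FinftyD.
  rewrite -big_split; apply: eq_bigr => i _; apply/funext => x.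
  exact/esym/opD.
- move=> _ U [g Fg ->] FU; exists (fun i => g i \o U) => [i|]; first exact: Finfty_comp.
  by apply/funext => x; rewrite -[LHS]/((\sum_i (X i \o g i)) (U x)) !op_sumE.
Qed.

Lemma Finfty_shifted l i : Finfty (shifted l i).
Proof. by apply: rcommutant_Finfty; exact: rcommutant_shifted. Qed.

(** One direction reads |h|^2 off the identity sum_i X_i g_i = 1 by Cauchy-Schwarz; the other is
    [corona] for the shifted operators. *)
Lemma notin_right_spectrum l : (0 < k)%N -> ~ right_spectrum f l <-> bounded_below l.
Proof.
move=> k0; rewrite -[right_spectrum f l]/(~ right_ideal_gen (shifted l) (@idop R n)).
split=> [/contrapT|[c c0 H]].
  rewrite right_ideal_gen_id; last exact: Finfty_shifted.
  move=> [g [Fg gE]].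
  have [M M0 gM] := uniform_bound (fun i => (Finfty_rcommutant (Fg i)).1).
  have K0 : 0 < k%:R :> R by rewrite ltr0n.
  exists ((k%:R * M ^+ 2)^-1) => [|h]; first by rewrite invr_gt0 mulr_gt0// exprn_gt0.
  set S := \sum_i _; rewrite ler_pdivrMl ?mulr_gt0 ?exprn_gt0//.
  have E : hnorm h ^+ 2 = \sum_i Re (inner (g i h) (adjoint (shifted l i) h)).
    rewrite -[LHS]/(Re (hnorm h ^+ 2)%:C) -inner_self -{1}[h]/(@idop R n h) -gE.
    rewrite op_sumE inner_suml Re_sum; apply: eq_bigr => i _.
    by rewrite -(adjointE _ _ (rcommutant_shifted l i).1).
  (* The weight 1 / (2 k) makes the k terms add up to half of |h|^2, which the left side absorbs. *)
  have L i : Re (inner (g i h) (adjoint (shifted l i) h)) <=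
      hnorm h ^+ 2 / (2 * k%:R) + k%:R * M ^+ 2 / 2 * hnorm (adjoint (shifted l i) h) ^+ 2.
    set b := hnorm (adjoint _ _).
    have b0 : 0 <= b by exact: hnorm_ge0.
    apply: le_trans (Re_inner_le _ _) _; apply: (@le_trans _ _ (M * hnorm h * b)).
      by rewrite ler_wpM2r.
    have N : k%:R != 0 :> R by rewrite gt_eqF.
    have := sqr_ge0 (hnorm h - k%:R * M * b).
    have -> : hnorm h ^+ 2 / (2 * k%:R) + k%:R * M ^+ 2 / 2 * b ^+ 2 =
      M * hnorm h * b + (2 * k%:R)^-1 * (hnorm h - k%:R * M * b) ^+ 2 by field.
    by move=> H; rewrite lerDl mulr_ge0// invr_ge0 mulr_ge0// ltW.
  have : hnorm h ^+ 2 <= hnorm h ^+ 2 / 2 + k%:R * M ^+ 2 / 2 * S.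
    have LS := @ler_sum R _ (index_enum 'I_k) xpredT _ _ (fun i _ => L i).
    rewrite {1}E; apply: (le_trans LS).
    rewrite big_split /= sumr_const card_ord -mulr_sumr -/S lerD2r.
    by rewrite -[leLHS]mulr_natr le_eqVlt; apply/orP; left; apply/eqP; field; rewrite gt_eqF.
  lra.
apply; rewrite right_ideal_gen_id; last exact: Finfty_shifted.
have c2 : 0 < c / 2 by rewrite divr_gt0.
apply: (corona c2 (rcommutant_shifted l)) => h.
have -> : 2 * (c / 2) = c by field.
exact: H.
Qed.

Lemma closed_right_spectrum : (0 < k)%N -> closed (right_spectrum f).
Proof.
move=> k0 p /closure_rowP cp; apply: contrapT; rewrite notin_right_spectrum//.
move=> [c c0 H]; have K0 : 0 < k%:R :> R by rewrite ltr0n.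
have r0 : 0 < c / (4 * k%:R) by rewrite divr_gt0// mulr_gt0.
(* If every |p_i - q_i|^2 is at most c / (4 k), then c |h|^2 <= 2 S + (c / 2) |h|^2 with S the sum
   at [q], so the bound persists with constant c / 4. *)
have [|q Sq pq] := cp (Num.sqrt (c / (4 * k%:R))); first by rewrite sqrtr_gt0.
suff : bounded_below q by rewrite -notin_right_spectrum.
exists (c / 4) => [|h]; first by rewrite divr_gt0.
have L i : hnorm (adjoint (shifted p i) h) ^+ 2 <=
    2 * hnorm (adjoint (shifted q i) h) ^+ 2 + c / (2 * k%:R) * hnorm h ^+ 2.
  pose d := p 0 i - q 0 i.
  have -> : adjoint (shifted p i) h = adjoint (shifted q i) h + d^* *: h.
    rewrite !adjoint_shifted /d cJD cJN scalerDl scaleNr.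
    by rewrite [RHS]addrC addrA subrK.
  have d2 : nc d ^+ 2 <= c / (4 * k%:R).
    rewrite -(sqr_sqrtr (ltW r0)) ler_sqr ?nnegrE ?nc_ge0 ?sqrtr_ge0//.
    exact/ltW/pq.
  have := hnormD (adjoint (shifted q i) h) (d^* *: h); rewrite hnormZ ncJ.
  set A := hnorm (adjoint _ _); set B := hnorm (_ + _); set N := hnorm h => BA.
  have N0 : 0 <= N ^+ 2 by exact: sqr_ge0.
  have B0 : 0 <= B by exact: hnorm_ge0.
  have dN := ler_wpM2r N0 d2.
  have -> : c / (2 * k%:R) = 2 * (c / (4 * k%:R)) by field; rewrite gt_eqF.
  have : B ^+ 2 <= (A + nc d * N) ^+ 2.
    by rewrite ler_sqr ?nnegrE// (le_trans B0).
  have := sqr_ge0 (A - nc d * N); nra.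
have LS := @ler_sum R _ (index_enum 'I_k) xpredT _ _ (fun i _ => L i).
have := le_trans (H h) LS.
rewrite big_split /= sumr_const card_ord -mulr_sumr.
have -> : c / (2 * k%:R) * hnorm h ^+ 2 *+ k = c / 2 * hnorm h ^+ 2.
  by rewrite -mulr_natr; field; rewrite gt_eqF.
set N := hnorm h ^+ 2; set S := \sum_(i < k) hnorm (adjoint (shifted q i) h) ^+ 2.
by clear -c0; move: N S => N S; lra.
Qed.

(** A unit vector g violating the lower bound makes every X_i^* g small, and l_i - <f_i g, g> = <g,
    X_i^* g>. *)
Lemma right_spectrum_num_range : (0 < k)%N ->
  right_spectrum f `<=` closure (num_range setT f).
Proof.
move=> k0 l Sl; apply/closure_rowP => e e_gt0; apply: contrapT => noa.
suff : bounded_below l by rewrite -notin_right_spectrum.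
exists (e ^+ 2) => [|h]; first by rewrite exprn_gt0.
have [->|h0] := eqVneq (hnorm h) 0.
  by rewrite expr0n mulr0 sumr_ge0// => i _; exact: sqr_ge0.
rewrite leNgt; apply/negP => hS; apply: noa.
have hp : 0 < hnorm h by rewrite lt_neqAle eq_sym h0 hnorm_ge0.
pose g := ((hnorm h)^-1)%:C *: h.
have g1 : hnorm g = 1 by rewrite hnormZ nc_real gtr0_norm ?invr_gt0// mulVf.
exists (\row_i inner (f i g) g); first by exists g.
move=> i; rewrite mxE.
have bX := (rcommutant_shifted l i).1.
have -> : l 0 i - inner (f i g) g = inner g (adjoint (shifted l i) g).
  rewrite -(adjointE _ _ bX) -[shifted l i g]/(l 0 i *: g - f i g) innerBl innerZl.
  by rewrite inner_self g1 expr1n mulr1.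
apply: le_lt_trans (CauchySchwarz _ _) _; rewrite g1 mul1r /g.
rewrite (opZ (bounded_adjoint bX).1) hnormZ nc_real gtr0_norm ?invr_gt0//.
rewrite mulrC ltr_pdivrMr// -ltr_sqr ?nnegrE ?mulr_ge0 ?hnorm_ge0 ?(ltW e_gt0)//.
rewrite exprMn; apply: le_lt_trans hS; rewrite (bigD1 i)//= lerDl sumr_ge0// => j _.
exact: sqr_ge0.
Qed.

(** * Point evaluations as points of the spectrum *)

Section PointEvaluation.
Variable lam : 'rV[C^o]_n.
Hypothesis lam_ball : unit_ball lam.

Let mon w : C := \prod_(j <- w) lam 0 j.
Let rho : R := \sum_i nc (lam 0 i) ^+ 2.

Let rho1 : rho < 1.
Proof.
rewrite -ltcR; apply: le_lt_trans lam_ball; rewrite rmorph_sum le_eqVlt; apply/orP; left.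
by apply/eqP; apply: eq_bigr => i _; rewrite normCE rmorphXn.
Qed.

(** Words of length q contribute rho^q, so a geometric series bounds the total. *)
Let mon_sum m : sqsum (fun w => (mon w)^*) m <= (1 - rho)^-1.
Proof.
have r1 : 0 < 1 - rho by rewrite subr_gt0.
have rho0 : 0 <= rho by apply: sumr_ge0 => i _; exact: sqr_ge0.
have step q : sqsum (fun w => (mon w)^*) q.+1 = 1 + rho * sqsum (fun w => (mon w)^*) q.
  rewrite /sqsum big_words_cons ncJ /mon big_nil Normc.normc1 expr1n; congr (_ + _).
  rewrite mulr_sumr; apply: eq_bigr => w _; rewrite mulr_suml; apply: eq_bigr => i _.
  by rewrite !ncJ big_cons Normc.normcM exprMn.
rewrite -[leRHS]mul1r ler_pdivlMr//; elim: m => [|m IH].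
  apply: (@le_trans _ _ (sqsum (fun w => (mon w)^*) 0 * 1)).
    by rewrite ler_wpM2l ?sqsum_ge0// gerBl.
  rewrite mulr1 /sqsum big_words big_nat1 (big_pred1 [tuple]) => [|t]; last first.
    by apply/esym/eqP; exact: tuple0.
  by rewrite ncJ /mon big_nil Normc.normc1 expr1n.
by rewrite step; nra.
Qed.

(** Kernel vector of the point: pairing with it evaluates at [lam]. *)
Let z : F2 := Fock (in_fock_bound mon_sum).

Let rannihils_z w : rannihils w z = (mon w)^* *: z.
Proof.
apply: fockE => u; rewrite rannihilsE fvalZ -[z _]/((mon (u ++ w))^*) -[z u]/((mon u)^*).
by rewrite /mon big_cat cJM mulrC.
Qed.

(** Coefficients of [z] are multiplicative in the word, so [z] is an eigenvector of all right
    annihilations; [adjoint_coef] carries this over to the adjoint of [T]. *)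
Lemma adjoint_eigen T : rcommutant T -> adjoint T z = (point_eval T lam)^* *: z.
Proof.
move=> cT; apply: fockE => w; rewrite adjoint_coef// rannihils_z innerZl fvalZ.
rewrite -[z w]/((mon w)^*) mulrC; congr (_ * _); rewrite innerC; congr (_^*).
congr word_sum; apply/funext => v; rewrite -[z v]/((mon v)^*) cJK.
by [].
Qed.

(** At this point every adjoint of l_i - f_i annihilates [z], whose norm is at least 1, so no lower
    bound can hold. *)
Lemma point_eval_spectrum : (0 < k)%N ->
  right_spectrum f (\row_i point_eval (f i) lam).
Proof.
move=> k0; apply: contrapT; rewrite notin_right_spectrum// => -[c c0 /(_ z)].
rewrite big1 => [|i _]; last first.
  by rewrite adjoint_shifted mxE adjoint_eigen// subrr hnorm0 expr0n.
have z1 : 1 <= hnorm z.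
  have := nc_fval_le z [::]; rewrite -[z [::]]/((mon [::])^*) ncJ /mon big_nil.
  by rewrite Normc.normc1.
rewrite leNgt mulr_gt0// exprn_gt0//; lra.
Qed.

End PointEvaluation.
End Spectrum.
End JointRange.

Local Open Scope complex_scope.

Theorem theorem3p5 (R : realType) (n k : nat) (n_gt0 : (0 < n)%N)
    (k_gt0 : (0 < k)%N) (f : 'I_k -> fock R n -> fock R n)
    (f_Finfty : forall i, Finfty (f i)) :
  (forall m : nat,
     let W := num_range (poly_le m) (fun i => orthproj (poly_le m) \o f i) in
     convex_set W /\ compact W) /\
  (convex_set (closure (num_range setT f)) /\
   compact (closure (num_range setT f))) /\
  (forall l : 'rV[R[i]^o]_k,
     ~ right_spectrum f l <->
     exists2 delta : R, 0 < delta &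
       op_le ((delta ^+ 2)%:C *: @idop R n)
             (\sum_i ((l 0 i *: @idop R n - f i) \o
                      ((l 0 i)^* *: @idop R n - adjoint (f i))))) /\
  [/\ compact (right_spectrum f),
      closure [set (\row_i point_eval (f i) l : 'rV[R[i]^o]_k)
                 | l in @unit_ball R n]
        `<=` right_spectrum f
    & right_spectrum f `<=` closure (num_range setT f)].
Proof.
have cf i : rcommutant (f i) := Finfty_rcommutant (f_Finfty i).
have closed_spec := closed_right_spectrum cf k_gt0.
have spec_range := right_spectrum_num_range cf k_gt0.
split; [|split; [|split]].
- by move=> m W; split; [exact: convex_num_range_trunc|exact: compact_num_range_trunc].
- by split; [exact: convex_closure_num_range|exact: compact_closure_num_range].
- by move=> l; rewrite (notin_right_spectrum cf l k_gt0); exact: bounded_belowP.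
split=> //.
- exact: subclosed_compact closed_spec (compact_closure_num_range cf) spec_range.
- rewrite [X in _ `<=` X](closure_id _).1//; apply: closure_subset => _ [l lB <-].
  exact: point_eval_spectrum.
Qed.
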